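(* Let $\{(X_n,T_n,\varphi_n)\}_{n\in\mathbb{Z}}$ be a two-sided sequence satisfying conditions (A1)–(A4) of the context. Then for all sufficiently large $Q>0$, writing $\Lambda_n=\Lambda_n(Q)$, the following are true. [A] For every $n\in\mathbb{Z}$ and every sequence of measures $\{\sigma_\ell\in M(X_\ell)\}_{\ell\ge n}$, the limits $$\lambda_n=\lim_{k\to\infty}\frac{\langle \mathbf{L}_n^k\mathbf{1},\sigma_{n+k}\rangle}{\langle \mathbf{L}_{n+1}^{k-1}\mathbf{1},\sigma_{n+k}\rangle},\qquad m_n=\lim_{k\to\infty}\frac{(\mathbf{L}_n^k)^*\sigma_{n+k}}{\langle \mathbf{1},(\mathbf{L}_n^k)^*\sigma_{n+k}\rangle}$$ exist (the second in the weak* topology on $M(X_n)$) and are independent of the choice of $\{\sigma_\ell\}$. [B] Each real number $\lambda_n$ is positive, each $m_n$ is a probability measure, and $L_n^*m_{n+1}=\lambda_nm_n$ for all $n\in\mathbb{Z}$. [C] $(m_n)_{n\in\mathbb{Z}}$ is the unique sequence of Borel probability measures $m_n\in M(X_n)$ such that $L_n^*m_{n+1}$ is a scalar multiple of $m_n$ for every $n\in\mathbb{Z}$. [D] There are $C_1>0$ and $\gamma\in(0,1)$ such that for any $n\in\mathbb{Z}$, $k\ge\tau$, $\sigma\in M(X_{n+k})$, and $f\in\Lambda_n$, $$\Big|\log\lambda_n-\log\frac{\langle \mathbf{L}_n^k\mathbf{1},\sigma\rangle}{\langle \mathbf{L}_{n+1}^{k-1}\mathbf{1},\sigma\rangle}\Big|\le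 C_1\gamma^k\quad\text{and}\quad \Big|\langle f,m_n\rangle-\frac{\langle f,(\mathbf{L}_n^k)^*\sigma\rangle}{\langle\mathbf{1},(\mathbf{L}_n^k)^*\sigma\rangle}\Big|\le C_1\|f\|\gamma^k.$$ [E] With $\boldsymbol{\lambda}_n^k=\prod_{j=0}^{k-1}\lambda_{n+j}$: for every $n\in\mathbb{Z}$ and any sequence of functions $\{f_\ell\in\Lambda_\ell\}_{\ell\le n}$, the limit $$h_n=\lim_{k\to\infty}\frac{\mathbf{L}_{n-k}^kf_{n-k}}{\boldsymbol{\lambda}_{n-k}^k\langle f_{n-k},m_{n-k}\rangle}$$ exists in the uniform norm and is independent of the choice of the $f_\ell$. [F] For every $n\in\mathbb{Z}$, $h_n$ is strictly positive, lies in $\Lambda_n$, and satisfies $\int h_n\,dm_n=1$ and $L_nh_n=\lambda_nh_{n+1}$. [G] $(h_n)_{n\in\mathbb{Z}}$ is the unique sequence of functions $h_n\in\Lambda_n$ such that $\int h_n\,dm_n=1$ and $L_nh_n$ is a scalar multiple of $h_{n+1}$ for all $n\in\mathbb{Z}$. [H] There exist $C_2>0$ and $\gamma\in(0,1)$ such that for any $n\in\mathbb{Z}$, any $k\ge\tau$, and any $f\in\Lambda_{n-k}$, $$\Big\|h_n-\frac{\mathbf{L}_{n-k}^kf}{\boldsymbol{\lambda}_{n-k}^k\langle f,m_{n-k}\rangle}\Big\|\le C_2\gamma^k.$$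
   Context: Setting: for each $n\in\mathbb{Z}$, $(X_n,d_n)$ is a metric space, $T_n\colon X_n\to X_{n+1}$ a map, $\varphi_n\colon X_n\to\mathbb{R}$ a continuous function. Write $\mathbf{T}_n^k=T_{n+k-1}\circ\cdots\circ T_{n+1}\circ T_n\colon X_n\to X_{n+k}$. $B(x,\delta)$ denotes the closed ball of radius $\delta$. ''For all $n$'' means for all $n\in\mathbb{Z}$. (A1) Each $(X_n,d_n)$ is a compact metric space and each $T_n$ is continuous. There exists $D\in\mathbb{N}$ such that $1\le \#T_n^{-1}(x)\le D$ for every $n$ and every $x\in X_{n+1}$. (A2) There exist $\delta>0$ and $\rho\in(0,1)$ such that for all $n$ and all $x,x'\in X_n$ with $d_n(x,x')\le\delta$ we have $d_n(x,x')\le\rho\, d_{n+1}(T_n(x),T_n(x'))$. Moreover, for any $x\in X_n$, $T_n(B(x,\delta))\supset B(T_nx,\delta)$ in $X_{n+1}$. (A3) With $\delta$ as in (A2), there exists $\tau\in\mathbb{N}$ such that for every $n$ and $x\in X_n$, $\mathbf{T}_n^\tau(B(x,\delta))=X_{n+\tau}$. (A4) There exist $H>0$ and $\beta\in(0,1)$ such that for all $n$ and all $x,x'\in X_n$ with $d_n(x,x')\le\delta$, $|\varphi_n(x)-\varphi_n(x')|\le H d_n(x,x')^\beta$. Moreover there exists $V>0$ with $\|\varphi_n\|_\infty\le V$ for all $n$. Operators: $L_n\colon C(X_n)\to C(X_{n+1})$ is $(L_nf)(x)=\sum_{y\in T_n^{-1}(x)}e^{\varphi_n(y)}f(y)$,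 and $\mathbf{L}_n^k=L_{n+k-1}\circ\cdots\circ L_{n+1}\circ L_n\colon C(X_n)\to C(X_{n+k})$ ($\mathbf{L}_n^0$ is the identity). $M(X_n)$ is the set of positive (nonzero) finite Borel measures on $X_n$; $\langle f,m\rangle=\int f\,dm$. The dual operator $L_n^*\colon M(X_{n+1})\to M(X_n)$ is defined by $\langle f,L_n^*m\rangle=\langle L_nf,m\rangle$ for all $f\in C(X_n)$; similarly $(\mathbf{L}_n^k)^*\colon M(X_{n+k})\to M(X_n)$. $\mathbf{1}$ is the constant function $1$, and $\|\cdot\|$ is the sup norm. Cones: $C_n^+=\{f\in C(X_n): f\ge 0,\ f\not\equiv 0\}$ and, for $Q>0$, $$\Lambda_n(Q)=\{f\in C_n^+: f(x)\le e^{Qd_n(x,x')^\beta}f(x')\text{ whenever } d_n(x,x')\le\delta\}.$$ *)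

(* Defs.v *)
From HB Require Import structures.
From mathcomp Require Import all_boot all_order all_algebra.
From mathcomp Require Import all_classical all_reals all_analysis.

Set Implicit Arguments.
Unset Strict Implicit.
Unset Printing Implicit Defensive.

Import Order.TTheory GRing.Theory Num.Theory.
Import numFieldNormedType.Exports.

Local Open Scope classical_set_scope.
Local Open Scope ring_scope.
Local Open Scope card_scope.

(* The point only says that the space is nonempty; the measurable types of the
   library are required to be pointed. *)
#[short(type="pmetricType")]
HB.structure Definition PointedMetric (K : numDomainType) :=
  { M of Metric K M & Pointed M }.

Definition borel (T : ptopologicalType) := g_sigma_algebraType (@open T).

Section general.
Context {R : realType}.
Implicit Types X Y : pmetricType R.

(* [closed_ball] of the library is the closure of the open ball, which may be
   smaller than the closed ball of a metric space. *)
Definition cball X (x : X) (r : R) : set X := [set y | mdist x y <= r].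

Definition supnorm X (f : X -> R) : R := sup (range (fun x => `|f x|)).

Definition fmeas X := {finite_measure set (borel X) -> \bar R}.

(* M(X) *)
Definition posmeas X : set (fmeas X) := [set m | m setT != 0%E].

(* Measures of the library are functions on all subsets, so equality is only
   required on Borel sets. *)
Definition eqmeas X (m1 m2 : fmeas X) : Prop :=
  forall A : set (borel X), measurable A -> m1 A = m2 A.

Definition scalar_multiple X (c : R) (m1 m2 : fmeas X) : Prop :=
  forall A : set (borel X), measurable A -> m1 A = (c%:E * m2 A)%E.

Definition pairing X (f : X -> R) (m : fmeas X) : R :=
  \int[m]_(x in [set: borel X]) f x.

Definition weak_star_cvg X (m_ : nat -> fmeas X) (m : fmeas X) : Prop :=
  forall f : X -> R, continuous f ->
    (fun k => pairing f (m_ k)) @ \oo --> pairing f m.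

(* m / <1, m>; the Dirac measure is the junk value for m = 0. *)
Definition normalized X (m : fmeas X) : fmeas X :=
  mnormalize m (\d_(point : borel X) : probability (borel X) R).

(* For a positive operator L : C(X) -> C(Y), the measure L^* m characterized by
   <f, L^* m> = <L f, m> for all f in C(X); it exists by the Riesz
   representation theorem and is unique up to [eqmeas]. *)
Definition dual X Y (L : (X -> R) -> (Y -> R)) (m : fmeas Y) : fmeas X :=
  xget (mzero : {classic fmeas X})
    [set m' : {classic fmeas X} | forall f : X -> R, continuous f ->
      pairing f (m' : fmeas X) = pairing (L f) m].

End general.

Lemma shift0 (n : int) : n = n + 0%N%:Z.
Proof. by rewrite addr0. Qed.

Lemma shiftS (n : int) (k : nat) : n + k%:Z + 1 = n + k.+1%:Z.
Proof. by rewrite -addrA -PoszD addn1. Qed.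

Lemma shiftSl (n : int) (k : nat) : n + 1 + k%:Z = n + k.+1%:Z.
Proof. by rewrite -addrA -PoszD add1n. Qed.

Section system.
Context {R : realType} {X : int -> pmetricType R}.
Variables (T : forall n : int, X n -> X (n + 1)) (phi : forall n : int, X n -> R).

(* X_{(n+k)+1} and X_{n+(k+1)} are not convertible: points and functions are
   moved along equalities of indices. *)
Definition castpt (i j : int) (e : i = j) (x : X i) : X j :=
  ecast l (X l) e x.

Definition castfun (i j : int) (e : i = j) (f : X i -> R) : X j -> R :=
  ecast l (X l -> R) e f.

Fixpoint iterT (n : int) (k : nat) : X n -> X (n + k%:Z) :=
  match k with
  | 0 => castpt (shift0 n)
  | k'.+1 => fun x => castpt (shiftS n k') (T (@iterT n k' x))
  end.

Definition condA1 : Prop :=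
  (forall n, compact [set: X n]) /\
  (forall n, continuous (@T n)) /\
  exists D : nat, forall n (x : X (n + 1)),
    exists k : nat, (1 <= k <= D)%N /\ @T n @^-1` [set x] #= `I_k.

Definition condA2 (delta : R) : Prop :=
  0 < delta /\
  (exists rho : R, 0 < rho < 1 /\
    forall n (x x' : X n), mdist x x' <= delta ->
      mdist x x' <= rho * mdist (T x) (T x')) /\
  forall n (x : X n), cball (T x) delta `<=` @T n @` cball x delta.

Definition condA3 (delta : R) (tau : nat) : Prop :=
  forall n (x : X n), @iterT n tau @` cball x delta = setT.

Definition condA4 (delta beta : R) : Prop :=
  0 < beta < 1 /\
  (exists H : R, 0 < H /\
    forall n (x x' : X n), mdist x x' <= delta ->
      `|phi x - phi x'| <= H * mdist x x' `^ beta) /\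
  exists V : R, 0 < V /\ forall n, supnorm (@phi n) <= V.

(* The sum is over the finite fibre of T_n, see [condA1]. *)
Definition transfer (n : int) (f : X n -> R) : X (n + 1) -> R :=
  fun x => \sum_(y \in @T n @^-1` [set x]) expR (phi y) * f y.

Fixpoint transfer_iter (n : int) (k : nat) (f : X n -> R) : X (n + k%:Z) -> R :=
  match k with
  | 0 => castfun (shift0 n) f
  | k'.+1 => castfun (shiftS n k') (transfer (@transfer_iter n k' f))
  end.

(* The iterate L_{n-k}^k, with its values seen as functions on X_n. *)
Definition transfer_from (n : int) (k : nat) (f : X (n - k%:Z) -> R) :
    X n -> R :=
  castfun (subrK k%:Z n) (@transfer_iter _ k f).

(* <L_n^{k+1} 1, sigma> / <L_{n+1}^k 1, sigma> for sigma in M(X_{n+k+1}): the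
   length is shifted by one because L_{n+1}^{k-1} only makes sense for k >= 1. *)
Definition lratio (n : int) (k : nat) (sigma : fmeas (X (n + k.+1%:Z))) : R :=
  pairing (@transfer_iter _ k.+1 (cst 1 : X n -> R)) sigma /
  pairing (castfun (shiftSl n k) (@transfer_iter _ k (cst 1 : X (n + 1) -> R)))
    sigma.

Definition dual_iter (n : int) (k : nat) (sigma : fmeas (X (n + k%:Z))) :
    fmeas (X n) :=
  dual (@transfer_iter n k) sigma.

Definition cone (delta beta Q : R) (n : int) : set (X n -> R) :=
  [set f : X n -> R | continuous f /\ (forall x, 0 <= f x) /\ (exists x, f x != 0) /\
    forall x x' : X n, mdist x x' <= delta ->
      f x <= expR (Q * mdist x x' `^ beta) * f x'].

End system.

Arguments iterT {R X} T n k x.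
Arguments transfer {R X} T phi n f x.
Arguments transfer_iter {R X} T phi n k f x.
Arguments transfer_from {R X} T phi n k f x.
Arguments lratio {R X} T phi n k sigma.
Arguments dual_iter {R X} T phi n k sigma.
Arguments cone {R X} delta beta Q n.

Definition lprod {R : realType} (lambda : int -> R) (n : int) (k : nat) : R :=
  \prod_(j < k) lambda (n + j%:Z).

(* Main.v *)
From HB Require Import structures.
Require Import Defs.
From mathcomp Require Import all_boot all_order all_algebra.
From mathcomp Require Import all_classical all_reals all_analysis.
From mathcomp Require Import measurable_realfun finmap ring lra.

Set Implicit Arguments.
Unset Strict Implicit.
Unset Printing Implicit Defensive.

Import Order.TTheory GRing.Theory Num.Theory.
Import numFieldNormedType.Exports.

Local Open Scope classical_set_scope.
Local Open Scope ring_scope.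

(** The spaces X_n, the maps T_n and the potentials phi_n are glued into one
    expanding map on the disjoint union [total] of the X_n.  The operators L_n
    become one transfer operator [ruelle] on functions on that union, whose
    iterates compose without moving functions along equalities of indices; a
    statement about X_n is a statement about the points of level n.

    Let [lcone c n] be the cone of the functions that are nonnegative on level
    n and satisfy f x <= exp (c d(x, x')^beta) f x' for x, x' of level n at
    distance at most delta.  Three facts carry the proof.
    - For Q large, the operator maps [lcone Q n] into [lcone (sigma Q) (n + 1)]
      with sigma < 1 ([ruelle_cone]).
    - After tau steps the values of the image on one level are pairwise
      comparable, up to a constant K ([lcone_harnack]).
    - An element of the narrow cone [lcone (sigma Q) n] stays in the wide cone
      [lcone Q n] when a constant that is small relative to its values is
      subtracted ([lcone_sub_cst]).
    Let f and g be in the cone and let L^k f and L^k g agree at a point y.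
    After tau + 1 steps the same constant can be subtracted from the images of
    f and g, and it can be chosen to account for a fixed proportion of the
    common value at y at time k.  This leaves two functions of the cone
    with the same difference and a smaller common value at y.  Repeating this
    shows that L^k f - L^k g is exponentially small relative to its common
    value at y ([contraction]).  Equivalently, the oscillation of the ratio
    L^k f / L^k g on a level is exponentially small ([cross_ratio]); this plays
    the part of the contraction of the Hilbert metric.

    So the ratios L^k f / L^k 1 converge uniformly to a number [mean n f], for f
    in the cone and, by density, for every f that is continuous on X_n.  This
    number is a positive linear functional of f, and the Riesz representation
    theorem ([riesz]) turns it into the measure m_n, called [conformal] below.
    The number lambda_n is the mean of L_n 1 at level n + 1.  Integrating the
    pointwise estimates against an arbitrary measure gives the limits and rates
    for lambda_n and m_n.  A sequence of probability measures permuted by the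
    dual operators up to scalars has the integrals of L^k f / L^k 1 as its
    values, hence is m_n.

    Finally the functions L^k f / mean (L^k f), for f in the cone at level
    n - k, form a Cauchy sequence in k whose limit [eigenfun] does not depend
    on the choice of f: this is h_n, and every sequence of normalized functions
    of the cones that the operators permute up to scalars is equal to its own
    normalized images, hence to h_n. *)

(** * Transfer operator of a finite-to-one map *)

Section ruelle_operator.
Context {R : realType} {E : choiceType}.
Variables (S : E -> E) (psi : E -> R) (D : nat) (V : R).
Hypothesis fibre_card : forall x, exists k : nat,
  (1 <= k <= D)%N /\ (S @^-1` [set x] #= `I_k)%card.
Hypothesis psi_le : forall x, `|psi x| <= V.
Implicit Types (F G : E -> R) (x y : E) (k : nat).

Definition ruelle F : E -> R :=
  fun x => \sum_(y \in S @^-1` [set x]) expR (psi y) * F y.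

Definition fibre x : {fset E} := fset_set (S @^-1` [set x]).

Lemma finite_fibre x : finite_set (S @^-1` [set x]).
Proof. by have [k [_ Sk]] := fibre_card x; exists k. Qed.

Lemma in_fibre x y : (y \in fibre x) = (S y == x).
Proof.
rewrite in_fset_set; last exact: finite_fibre.
by apply/idP/eqP => [/set_mem//|Sy]; apply/mem_set.
Qed.

Lemma ruelleE F x : ruelle F x = \sum_(y <- fibre x) expR (psi y) * F y.
Proof. by rewrite /ruelle fsbig_finite//; exact: finite_fibre. Qed.

Lemma card_fibre x : (1 <= #|` fibre x| <= D)%N.
Proof.
have [k [kD Sk]] := fibre_card x.
suff -> : #|` fibre x| = k by [].
exact: (card_fset_set Sk).
Qed.

Lemma fibre_neq0 x : exists y, S y = x.
Proof.
have /andP[+ _] := card_fibre x.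
by rewrite cardfs_gt0 => /fset0Pn[y]; rewrite in_fibre => /eqP; exists y.
Qed.

Lemma le_ruelle F G x : (forall y, S y = x -> F y <= G y) ->
  ruelle F x <= ruelle G x.
Proof.
move=> FG; rewrite !ruelleE big_seq [leRHS]big_seq; apply: ler_sum => y.
by rewrite in_fibre => /eqP /FG; rewrite ler_pM2l ?expR_gt0.
Qed.

Lemma le_iter_ruelle k F G x : (forall y, iter k S y = x -> F y <= G y) ->
  iter k ruelle F x <= iter k ruelle G x.
Proof.
elim: k x => [|k IH] x FG /=; first exact: FG.
by apply: le_ruelle => y Sy; apply: IH => z Sz; apply: FG; rewrite iterS Sz.
Qed.

Lemma iter_ruelleD k F G : iter k ruelle (F \+ G) =
  iter k ruelle F \+ iter k ruelle G.
Proof.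
elim: k => // k IH; rewrite !iterS IH; apply/funext => x /=.
by rewrite !ruelleE -big_split; apply: eq_bigr => y _; rewrite mulrDr.
Qed.

Lemma iter_ruelleZ k c F : iter k ruelle (c \*o F) = c \*o iter k ruelle F.
Proof.
elim: k => // k IH; rewrite !iterS IH; apply/funext => x /=.
by rewrite !ruelleE mulr_sumr; apply: eq_bigr => y _; rewrite /= mulrCA.
Qed.

Lemma iter_ruelleB k F G : iter k ruelle (F \- G) =
  iter k ruelle F \- iter k ruelle G.
Proof.
have -> : F \- G = F \+ (-1 \*o G) by apply/funext => x /=; rewrite mulN1r.
by rewrite iter_ruelleD iter_ruelleZ; apply/funext => x /=; rewrite mulN1r.
Qed.

Lemma iter_ruelle_ge0 k F x : (forall y, iter k S y = x -> 0 <= F y) ->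
  0 <= iter k ruelle F x.
Proof.
move=> F0; have -> : 0 = iter k ruelle (0 \*o F) x.
  by rewrite iter_ruelleZ /= mul0r.
by apply: le_iter_ruelle => y /F0; rewrite /= mul0r.
Qed.

Lemma ruelle1_ge x : expR (- V) <= ruelle (cst 1) x.
Proof.
have [y Sy] := fibre_neq0 x.
rewrite ruelleE (big_fsetD1 y) ?in_fibre ?Sy//= mulr1 ler_wpDr//.
  by rewrite sumr_ge0// => z _; rewrite mulr1 expR_ge0.
by rewrite ler_expR; have := psi_le y; rewrite ler_norml => /andP[].
Qed.

Lemma ruelle1_le x : ruelle (cst 1) x <= D%:R * expR V.
Proof.
rewrite ruelleE (@le_trans _ _ (\sum_(y <- fibre x) expR V))//.
  apply: ler_sum => y _; rewrite mulr1 ler_expR.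
  by have := psi_le y; rewrite ler_norml => /andP[].
rewrite big_const_seq count_predT iter_addr_0 -[leLHS]mulr_natl.
rewrite ler_wpM2r ?expR_ge0// ler_nat.
by have /andP[] := card_fibre x.
Qed.

Lemma iter_ruelle1_gt0 k x : 0 < iter k ruelle (cst 1) x.
Proof.
elim: k x => [|k IH] x /=; first exact: ltr01.
have [y Sy] := fibre_neq0 x.
rewrite ruelleE (big_fsetD1 y) ?in_fibre ?Sy//= ltr_wpDr ?mulr_gt0 ?expR_gt0//.
by rewrite sumr_ge0// => z _; rewrite mulr_ge0 ?expR_ge0// ltW.
Qed.

Lemma iter_ruelle1_le k x :
  iter k ruelle (cst 1) x <= (D%:R * expR V) ^+ k.
Proof.
elim: k x => [|k IH] x //=.
apply: (@le_trans _ _ (iter 1 ruelle (((D%:R * expR V) ^+ k) \*o cst 1) x)).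
  by apply: le_ruelle => y _; rewrite /= mulr1.
rewrite iter_ruelleZ /=.
rewrite exprSr ler_wpM2l ?ruelle1_le// exprn_ge0//.
Qed.

Lemma iter_ruelle_ge k F y : (forall z, iter k S z = iter k S y -> 0 <= F z) ->
  expR (- V) ^+ k * F y <= iter k ruelle F (iter k S y).
Proof.
elim: k F y => [|k IH] F y F0; first by rewrite expr0 mul1r.
rewrite (iterSr k S y) in F0 *; rewrite (iterSr k ruelle F).
rewrite exprSr -mulrA (le_trans _ (IH _ _ _))//; last first.
  by move=> z Sz; rewrite (@iter_ruelle_ge0 1)// => w /= Sw; rewrite F0// iterSr Sw.
rewrite ler_wpM2l ?exprn_ge0 ?expR_ge0//.
rewrite ruelleE (big_fsetD1 y) ?in_fibre//= ler_wpDr//.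
  rewrite big_seq sumr_ge0// => z; rewrite !inE in_fibre => /andP[_ /eqP Sz].
  by rewrite mulr_ge0 ?expR_ge0 ?F0// iterSr Sz.
have Fy : 0 <= F y by rewrite F0// iterSr.
by rewrite ler_wpM2r// ler_expR; have := psi_le y; rewrite ler_norml => /andP[].
Qed.

End ruelle_operator.

(** * Elementary inequalities *)

Lemma ler_sum_inj {R : realType} {E : choiceType} (A B : {fset E})
    (s : E -> E) (F : E -> R) :
  {in A, forall y, s y \in B} -> {in A &, injective s} ->
  {in B, forall z, 0 <= F z} ->
  \sum_(y <- A) F (s y) <= \sum_(z <- B) F z.
Proof.
move=> sAB sinj F0.
have -> : \sum_(y <- A) F (s y) = \sum_(z <- (s @` A)%fset) F z by rewrite big_imfset.
rewrite [leRHS](big_fsetID _ (mem (s @` A)%fset))/=.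
have -> : [fset x | x in B & x \in (s @` A)%fset]%fset = (s @` A)%fset.
  apply/fsetP => z; rewrite !inE/=; apply/andP/idP => [[]//|zA]; split=> //.
  by move/imfsetP : zA => [y /= yA ->]; exact: sAB.
rewrite lerDl big_seq sumr_ge0// => z; rewrite !inE/= => /andP[zB _].
exact: F0.
Qed.

Lemma bernoulli_le {R : realType} (u : R) k : 0 <= u <= 1 ->
  1 - k%:R * u <= (1 - u) ^+ k.
Proof.
move=> /andP[u0 u1]; elim: k => [|k IH]; first by rewrite mul0r subr0 expr0.
rewrite exprS (le_trans _ (ler_wpM2l _ IH)) ?subr_ge0//.
rewrite -natr1; have : 0 <= k%:R * u * u by rewrite !mulr_ge0.
lra.
Qed.

Lemma geometric_le {R : realType} (C g e : R) : 0 <= g < 1 -> 0 < e ->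
  forall k0, exists2 k, (k0 <= k)%N & C * g ^+ k <= e.
Proof.
move=> /andP[g0 g1] e0 k0.
have /cvgrPdist_le/(_ e e0)[N _ NP] : (fun k => C * g ^+ k) @ \oo --> (0 : R).
  by rewrite -[0](mulr0 C); apply: cvgMr; apply: cvg_expr; rewrite ger0_norm.
exists (maxn k0 N); first exact: leq_maxl.
have := NP (maxn k0 N) (leq_maxr _ _); rewrite /= sub0r normrN.
exact/le_trans/ler_norm.
Qed.

(** * Expanding maps over the integers *)

(** [lev x] is the index of the space that contains x.  The metric enters only
    through the relation [near], distance at most delta, and through t, the
    power beta of the distance; accordingly a, r and b stand for delta^beta,
    rho^beta and (delta / 2)^beta.  The field [exp_sep] is what remains of the
    triangle inequality: two preimages of one point can be near a common point
    z only if the images are at least delta / 2 apart. *)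
Record expanding {R : realType} {E : choiceType} (S : E -> E) (psi : E -> R)
    (lev : E -> int) (near : E -> E -> Prop) (t : E -> E -> R)
    (D tau : nat) (V H r a b : R) : Prop := {
  exp_card : forall x, exists k : nat,
    (1 <= k <= D)%N /\ (S @^-1` [set x] #= `I_k)%card ;
  exp_psi_le : forall x, `|psi x| <= V ;
  exp_psi_near : forall x y, near x y -> `|psi x - psi y| <= H * t x y ;
  exp_level : forall n, exists x, lev x = n ;
  exp_levS : forall x, lev (S x) = lev x + 1 ;
  exp_near_lev : forall x y, near x y -> lev y = lev x ;
  exp_t_ge0 : forall x y, 0 <= t x y ;
  exp_t_le : forall x y, near x y -> t x y <= a ;
  exp_lift : forall y x, near (S y) x -> exists2 z, near y z & S z = x ;
  exp_contract : forall x y, near x y -> t x y <= r * t (S x) (S y) ;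
  exp_sep : forall x y z, x != y -> S x = S y -> near x z -> near y z ->
    b <= t (S x) (S z) ;
  exp_mix : forall x w, lev w = lev x + tau%:Z ->
    exists2 y, near x y & iter tau S y = w ;
  exp_H : 0 <= H ; exp_r : 0 < r < 1 ; exp_a : 0 <= a ; exp_b : 0 < b ;
}.

Section expanding_dynamics.
Context {R : realType} {E : choiceType}.
Variables (S : E -> E) (psi : E -> R) (lev : E -> int) (near : E -> E -> Prop).
Variables (t : E -> E -> R) (D tau : nat) (V H r a b : R).
Hypothesis sys : expanding S psi lev near t D tau V H r a b.
Implicit Types (F G : E -> R) (x y : E) (k : nat) (n : int) (c e : R).

Let card := exp_card sys.
Let psi_le := exp_psi_le sys.
Let pt n : E := sval (cid (exp_level sys n)).
Let lev_pt n : lev (pt n) = n := svalP (cid (exp_level sys n)).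
Local Notation L := (ruelle S psi).
Local Notation W k := (iter k L (cst 1)).
Let W0 k x : 0 < W k x := iter_ruelle1_gt0 psi card k x.

Lemma lev_iter k y : lev (iter k S y) = lev y + k%:Z.
Proof.
elim: k => [|k IH]; first by rewrite addr0.
by rewrite iterS (exp_levS sys) IH -addrA -PoszD addn1.
Qed.

(** * Limits of the ratios of iterates *)

(** The ratio L^k F / L^k 1 lies within e of c on level n + k, written without
    division. *)
Definition approx n F c e k := forall x, lev x = n + k%:Z ->
  `|iter k L F x - c * W k x| <= e * W k x.

Definition tends n F c := forall e, 0 < e -> exists k, approx n F c e k.

(** The limit of L^k F / L^k 1, encoded as the supremum of the lower bounds of
    these ratios: lower bounds at time k persist at later times, so this
    supremum is meaningful even before convergence is known. *)
Definition mean n F : R := sup [set c | exists k, forall x, lev x = n + k%:Z ->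
  c * W k x <= iter k L F x].

Lemma le_ruelle_lev n k F G x : (forall y, lev y = n -> F y <= G y) ->
  lev x = n + k%:Z -> iter k L F x <= iter k L G x.
Proof.
move=> FG lx; apply: (le_iter_ruelle psi card) => y yx; apply: FG.
by apply: (@addIr _ k%:Z); rewrite -lx -yx lev_iter.
Qed.

Lemma eq_ruelle_lev n k F G x : (forall y, lev y = n -> F y = G y) ->
  lev x = n + k%:Z -> iter k L F x = iter k L G x.
Proof.
by move=> FG lx; apply/eqP; rewrite eq_le !(@le_ruelle_lev n)// => y /FG ->.
Qed.

(** L^(k + j) F / L^(k + j) 1 is a weighted average of the values of
    L^k F / L^k 1, so that bounds on the ratio persist. *)
Lemma le_iterW k k' n F c : (k <= k')%N ->
  (forall x, lev x = n + k%:Z -> iter k L F x <= c * W k x) ->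
  forall x, lev x = n + k'%:Z -> iter k' L F x <= c * W k' x.
Proof.
move=> /subnK <-; set j := (k' - k)%N => FW x lx; rewrite !iterD.
have /(congr1 (@^~ x))/= <- := iter_ruelleZ psi card j c (W k).
by apply: (@le_ruelle_lev (n + k%:Z)) => //; rewrite lx addnC PoszD addrA.
Qed.

Lemma ge_iterW k k' n F c : (k <= k')%N ->
  (forall x, lev x = n + k%:Z -> c * W k x <= iter k L F x) ->
  forall x, lev x = n + k'%:Z -> c * W k' x <= iter k' L F x.
Proof.
move=> /subnK <-; set j := (k' - k)%N => FW x lx; rewrite !iterD.
have /(congr1 (@^~ x))/= <- := iter_ruelleZ psi card j c (W k).
by apply: (@le_ruelle_lev (n + k%:Z)) => //; rewrite lx addnC PoszD addrA.
Qed.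

Lemma approxP n F c e k : approx n F c e k <->
  (forall x, lev x = n + k%:Z -> iter k L F x <= (c + e) * W k x) /\
  (forall x, lev x = n + k%:Z -> (c - e) * W k x <= iter k L F x).
Proof.
split=> [A|[A B] x lx].
  split=> x /A; rewrite ler_norml => /andP[h1 h2]; last by rewrite mulrBl; lra.
  by rewrite mulrDl; lra.
have := A x lx; have := B x lx; rewrite !mulrDl mulNr ler_norml => h1 h2.
by apply/andP; split; lra.
Qed.

Lemma approx_leq n F c e k k' : (k <= k')%N -> approx n F c e k ->
  approx n F c e k'.
Proof.
move=> kk' /approxP[A B]; apply/approxP; split; first exact: le_iterW A.
exact: ge_iterW B.
Qed.

(** Both approximations are compared at a common later time, at one point of
    that level. *)
Lemma approx_le_le n F G c c' e e' k k' B : approx n F c e k -> approx n G c' e' k' ->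
  (forall x, lev x = n -> F x <= G x + B) -> c - e <= c' + e' + B.
Proof.
move=> /(approx_leq (leq_maxl k k'))/approxP[_ A1].
move=> /(approx_leq (leq_maxr k k'))/approxP[A2 _] FG.
set m := maxn k k' in A1 A2; have lx := lev_pt (n + m%:Z).
have := A1 _ lx; have := A2 _ lx; set x := pt _ in lx *.
have := @le_ruelle_lev n m F (G \+ (B \*o cst 1)) x _ lx.
rewrite (iter_ruelleD psi card) (iter_ruelleZ psi card)/= mulr1.
move=> /(_ FG) FGB h2 h1; rewrite -(ler_pM2r (W0 m x)) (le_trans h1)//.
by rewrite (le_trans FGB)// [leRHS]mulrDl lerD2r.
Qed.

Lemma tends_le n F G c c' B : tends n F c -> tends n G c' ->
  (forall x, lev x = n -> F x <= G x + B) -> c <= c' + B.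
Proof.
move=> Fc Gc FG; apply/ler_addgt0Pr => e e0.
have e2 : 0 < e / 2 by rewrite divr_gt0.
have [k Fk] := Fc _ e2; have [k' Gk] := Gc _ e2.
have := approx_le_le Fk Gk FG; lra.
Qed.

Lemma tends_uniq n F c c' : tends n F c -> tends n F c' -> c = c'.
Proof.
move=> Fc Fc'; apply/eqP; rewrite eq_le -[leRHS]addr0 (tends_le Fc Fc'); last first.
  by move=> x _; rewrite addr0.
by rewrite -[leRHS]addr0 (tends_le Fc' Fc)// => x _; rewrite addr0.
Qed.

(** If the oscillation of the ratios on a level becomes arbitrarily small, then
    the ratios converge: every lower bound is below every upper bound. *)
Lemma tends_mean n F :
  (forall e, 0 < e -> exists k c, approx n F c e k) -> tends n F (mean n F).
Proof.
move=> qF; rewrite /mean; set A := (X in sup X).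
have subA e k c : approx n F c e k -> A (c - e).
  by move=> /approxP[_ B]; exists k.
have ubA e k c : approx n F c e k -> ubound A (c + e).
  move=> /approxP[U _] z [k' zF].
  have := ge_iterW (leq_maxl k' k) zF (lev_pt _).
  have := le_iterW (leq_maxr k' k) U (lev_pt _).
  by move=> h1 h2; have := le_trans h2 h1; rewrite ler_pM2r.
have [k1 [c1 A1]] := qF 1 ltr01.
have supA : has_sup A.
  by split; [exists (c1 - 1); exact: subA A1|exists (c1 + 1); exact: ubA A1].
move=> e e0; have [|k [c kc]] := qF (e / 2); first by rewrite divr_gt0.
have h1 : c - e / 2 <= sup A by apply: sup_upper_bound => //; exact: subA kc.
have h2 : sup A <= c + e / 2 by apply: sup_le_ub; [case: supA|exact: ubA kc].
exists k; case/approxP : kc => U B; apply/approxP; split=> x lx.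
  by rewrite (le_trans (U x lx))// ler_wpM2r ?(ltW (W0 _ _))//; lra.
by rewrite (le_trans _ (B x lx))// ler_wpM2r ?(ltW (W0 _ _))//; lra.
Qed.

Lemma mean_eq n F c : tends n F c -> mean n F = c.
Proof.
by move=> Fc; apply: (@tends_uniq n F) => //; apply: tends_mean => e /Fc[k]; exists k, c.
Qed.

Definition meanable n F := tends n F (mean n F).

Lemma meanable_tends n F c : tends n F c -> meanable n F.
Proof. by move=> Fc; rewrite /meanable (mean_eq Fc). Qed.

Lemma tends1 n : tends n (cst 1) 1.
Proof.
by move=> e e0; exists 0%N => x lx; rewrite mul1r subrr normr0 mulr_ge0 ?ltW.
Qed.

Lemma mean1 n : mean n (cst 1) = 1.
Proof. exact/mean_eq/tends1. Qed.

Lemma tendsD n F G c c' : tends n F c -> tends n G c' -> tends n (F \+ G) (c + c').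
Proof.
move=> Fc Gc e e0; have e2 : 0 < e / 2 by rewrite divr_gt0.
have [k Fk] := Fc _ e2; have [k' Gk] := Gc _ e2; exists (maxn k k') => x lx.
have := approx_leq (leq_maxl k k') Fk lx.
have := approx_leq (leq_maxr k k') Gk lx.
rewrite (iter_ruelleD psi card)/= => h1 h2.
rewrite mulrDl opprD addrACA (le_trans (ler_normD _ _))//.
by rewrite (le_trans (lerD h2 h1))// -mulrDl -splitr.
Qed.

Lemma tendsZ n F c z : tends n F c -> tends n (z \*o F) (z * c).
Proof.
move=> Fc e e0; have z0 : 0 < `|z| + 1 by rewrite ltr_wpDl.
have [|k Fk] := Fc (e / (`|z| + 1)); first by rewrite divr_gt0.
exists k => x lx; rewrite (iter_ruelleZ psi card)/= -mulrA -mulrBr normrM.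
rewrite (le_trans (ler_wpM2l _ (Fk x lx)))// mulrA ler_wpM2r ?(ltW (W0 _ _))//.
by rewrite mulrCA ler_piMr ?(ltW e0)// ler_pdivrMr// mul1r lerDl.
Qed.

Lemma meanD n F G : meanable n F -> meanable n G ->
  mean n (F \+ G) = mean n F + mean n G.
Proof. by move=> Fc Gc; apply/mean_eq/tendsD. Qed.

Lemma meanZ n z F : meanable n F -> mean n (z \*o F) = z * mean n F.
Proof. by move=> Fc; apply/mean_eq/tendsZ. Qed.

Lemma meanableD n F G : meanable n F -> meanable n G -> meanable n (F \+ G).
Proof. by move=> Fc Gc; exact: meanable_tends (tendsD Fc Gc). Qed.

Lemma meanableZ n z F : meanable n F -> meanable n (z \*o F).
Proof. by move=> Fc; exact: meanable_tends (tendsZ _ Fc). Qed.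

Lemma le_mean n F G B : meanable n F -> meanable n G ->
  (forall x, lev x = n -> F x <= G x + B) -> mean n F <= mean n G + B.
Proof. exact: tends_le. Qed.

Lemma mean_ge0 n F : meanable n F -> (forall x, lev x = n -> 0 <= F x) ->
  0 <= mean n F.
Proof.
move=> Fc F0; rewrite -(mul0r (mean n (cst 1))) -meanZ//; last first.
  exact: meanable_tends (tends1 _).
rewrite -[leRHS]addr0 le_mean//; first exact: meanableZ (meanable_tends (tends1 _)).
by move=> x lx; rewrite /= mul0r addr0 F0.
Qed.

Lemma eq_mean n F G : (forall x, lev x = n -> F x = G x) -> mean n F = mean n G.
Proof.
move=> FG; congr sup; apply/seteqP; split=> c [k kP]; exists k => x lx.
  by rewrite -(eq_ruelle_lev FG lx) kP.
by rewrite (eq_ruelle_lev FG lx) kP.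
Qed.

(** Ratios of functions at uniform distance e differ by at most e, so functions
    with a mean form a uniformly closed set. *)
Lemma meanable_approx n F : (forall e, 0 < e -> exists G, meanable n G /\
    forall x, lev x = n -> `|F x - G x| <= e) -> meanable n F.
Proof.
move=> FG; apply: tends_mean => e e0; have e2 : 0 < e / 2 by rewrite divr_gt0.
have [G [Gc {}FG]] := FG _ e2; have [k Gk] := Gc _ e2.
exists k, (mean n G) => x lx; have := Gk x lx.
have FGe y : lev y = n -> F y <= (G \+ (e / 2 \*o cst 1)) y.
  by move=> /FG; rewrite /= ler_norml mulr1 => /andP[]; lra.
have GFe y : lev y = n -> G y <= (F \+ (e / 2 \*o cst 1)) y.
  by move=> /FG; rewrite /= ler_norml mulr1 => /andP[]; lra.
have := le_ruelle_lev FGe lx; have := le_ruelle_lev GFe lx.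
rewrite !(iter_ruelleD psi card) (iter_ruelleZ psi card)/= !ler_norml.
move=> h1 h2 /andP[h3 h4]; rewrite (splitr e) mulrDl.
by apply/andP; split; lra.
Qed.

(** Since L^(k + 1) 1 / L^k 1 is the ratio of the iterates of L 1 and of 1 from
    level n + 1 on, its limit is a mean. *)
Definition lambda n : R := mean (n + 1) (L (cst 1)).

Lemma lambda_bounds n : meanable (n + 1) (L (cst 1)) ->
  expR (- V) <= lambda n <= D%:R * expR V.
Proof.
move=> m1; have meanc c : meanable (n + 1) (c \*o cst 1).
  exact: meanableZ (meanable_tends (tends1 _)).
have mc c : mean (n + 1) (c \*o cst 1) = c.
  by rewrite meanZ ?mean1 ?mulr1//; exact: meanable_tends (tends1 _).
apply/andP; split.
  rewrite -{1}[expR _]mc -[leRHS]addr0 le_mean// => x _.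
  by rewrite /= mulr1 addr0 (ruelle1_ge card psi_le).
rewrite -[leRHS]mc -[leRHS]addr0 le_mean// => x _.
by rewrite /= mulr1 addr0 (ruelle1_le card psi_le).
Qed.

(** L^k (L F) / L^k 1 is the product of L^(k + 1) F / L^(k + 1) 1, which tends
    to mean n F, and of L^k (L 1) / L^k 1, which tends to lambda n. *)
Lemma tends_ruelle n F : meanable (n + 1) (L (cst 1)) -> meanable n F ->
  tends (n + 1) (L F) (lambda n * mean n F).
Proof.
move=> m1 Fc e e0; set l := lambda n; set c := mean n F.
have /andP[l0 _] := lambda_bounds m1.
have {}l0 : 0 < l by rewrite (lt_le_trans (expR_gt0 _) l0).
have c0 : 0 < `|c| + 1 by rewrite ltr_wpDl.
pose e2 := e / 2 / (`|c| + 1).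
have e20 : 0 < e2 by rewrite !divr_gt0.
pose e1 := e / 2 / (l + e2).
have e10 : 0 < e1 by rewrite !divr_gt0// addr_gt0.
have [k Fk] := Fc _ e10; have [k' Gk] := m1 _ e20.
exists (maxn k k') => x lx.
have kk : (k <= (maxn k k').+1)%N by rewrite (leq_trans (leq_maxl k k')).
have := approx_leq kk Fk; have := approx_leq (leq_maxr k k') Gk lx.
set m := maxn k k' in kk lx *.
rewrite -/(lambda n) -/l -/c => h2 /(_ x); rewrite lx -addrA -PoszD add1n => /(_ erefl).
rewrite !iterSr; set A := iter m L (L F) x; set B := iter m L (L (cst 1)) x in h2 *.
set C := W m x in h2 * => h1; have C0 : 0 < C := W0 m x.
have -> : A - l * c * C = (A - c * B) + c * (B - l * C) by ring.
rewrite (le_trans (ler_normD _ _))// normrM.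
have BC : B <= (l + e2) * C by move: h2; rewrite ler_norml mulrDl => /andP[]; lra.
have h3 : e1 * B <= e / 2 * C.
  rewrite (le_trans (ler_wpM2l (ltW e10) BC))// mulrA divfK ?gt_eqF// addr_gt0//.
have h4 : `|c| * `|B - l * C| <= e / 2 * C.
  rewrite (le_trans (ler_wpM2l (normr_ge0 _) h2))// mulrA ler_wpM2r ?(ltW C0)//.
  rewrite /e2 mulrCA ler_piMr ?divr_ge0 ?(ltW e0)// ler_pdivrMr// mul1r.
  by rewrite lerDl.
by rewrite (splitr e) mulrDl lerD// (le_trans h1 h3).
Qed.

Lemma mean_ruelle n F : meanable (n + 1) (L (cst 1)) -> meanable n F ->
  mean (n + 1) (L F) = lambda n * mean n F.
Proof. by move=> m1 Fc; exact/mean_eq/tends_ruelle. Qed.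

Lemma mean_iter n k F : (forall n, meanable (n + 1) (L (cst 1))) -> meanable n F ->
  meanable (n + k%:Z) (iter k L F) /\
  mean (n + k%:Z) (iter k L F) = lprod lambda n k * mean n F.
Proof.
move=> m1 Fc; elim: k => [|k [IH1 IH2]].
  by rewrite addr0 /lprod big_ord0 mul1r.
rewrite -shiftS iterS; split.
  exact: (meanable_tends (tends_ruelle (m1 _) IH1)).
by rewrite (mean_ruelle (m1 _) IH1) IH2 /lprod big_ord_recr/= mulrA [lambda _ * _]mulrC.
Qed.

(** * Cones of regular functions *)

(** The zero function is kept in the cone, which makes the cone stable under
    subtraction of the extremal constant. *)
Definition lcone Q n F : Prop :=
  (forall x, lev x = n -> 0 <= F x) /\
  forall x y, lev x = n -> near x y -> F x <= expR (Q * t x y) * F y.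

Definition sigma : R := (1 + r) / 2.
(** The operator sends the aperture Q to at most (Q + H) r + ln D / b, and Qmin
    is chosen to make this at most sigma Q for Q >= Qmin. *)
Definition Qmin : R := 2 * (H + ln D%:R / b + 1) / (1 - r).

Let r0 : 0 < r. Proof. by case/andP: (exp_r sys). Qed.
Let r1 : r < 1. Proof. by case/andP: (exp_r sys). Qed.

Lemma D_gt0 : (0 < D)%N.
Proof. by have [k [/andP[k0 kD] _]] := card (pt 0); exact: leq_trans kD. Qed.

Lemma sigma_lt1 : 0 < sigma < 1.
Proof. by have h0 := r0; have h1 := r1; rewrite /sigma; apply/andP; split; lra. Qed.

Lemma Qmin_gt0 : 0 < Qmin.
Proof.
rewrite /Qmin divr_gt0 ?subr_gt0// mulr_gt0// ltr_wpDl//.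
rewrite addr_ge0 ?(exp_H sys)// divr_ge0 ?ln_ge0 ?ler1n ?D_gt0//.
exact/ltW/(exp_b sys).
Qed.

Variable Q : R.
Hypothesis QQ : Qmin <= Q.

Let Q0 : 0 < Q := lt_le_trans Qmin_gt0 QQ.

(** Each preimage y of x is lifted to a preimage s y of x' with
    t y (s y) <= r t x x', and the terms of the two sums are compared in pairs.
    If the lift is injective this bounds the sum at x by the sum at x'.
    Otherwise x and x' are far apart, t x x' >= b; then the cruder bound that
    costs a factor D is affordable, because D <= exp (ln D / b * t x x'). *)
Lemma ruelle_cone n F : lcone Q n F ->
  lcone (sigma * Q) (n + 1) (L F).
Proof.
move=> [F0 FQ]; have lev1 y x : lev x = n + 1 -> S y = x -> lev y = n.
  by move=> + Sy; rewrite -Sy (exp_levS sys) => /addIr.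
split=> [x lx|x x' lx xx'].
  by apply: (@iter_ruelle_ge0 _ _ _ _ _ card 1) => y /(lev1 _ _ lx); exact: F0.
have lx' : lev x' = n + 1 by rewrite (exp_near_lev sys xx').
have /choice[s Hs] : forall y, exists z, S y = x -> near y z /\ S z = x'.
  move=> y; have [Sy|Sy] := pselect (S y = x); last by exists y.
  by rewrite -Sy in xx'; have [z] := exp_lift sys xx'; exists z.
set u := t x x'; have u0 : 0 <= u := exp_t_ge0 sys x x'.
pose term y := expR (psi y) * F y.
pose c := expR ((Q + H) * (r * u)).
have H0 := exp_H sys.
have term0 y : S y = x' -> 0 <= term y.
  by move=> /(lev1 _ _ lx') ly; rewrite mulr_ge0 ?expR_ge0 ?F0.
have termc y : S y = x -> term y <= c * term (s y).
  move=> Sy; have [yz Sz] := Hs y Sy.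
  have tyz : t y (s y) <= r * u by rewrite /u -Sy -Sz; exact: (exp_contract sys yz).
  have := FQ _ _ (lev1 _ _ lx Sy) yz => /le_trans FF.
  have psiy : psi y <= H * (r * u) + psi (s y).
    have := exp_psi_near sys yz; rewrite ler_norml lerBlDr => /andP[_ /le_trans]; apply.
    by rewrite lerD2r ler_wpM2l.
  rewrite /term /c mulrDl expRD.
  rewrite (@le_trans _ _ (expR (H * (r * u) + psi (s y)) * F y))//.
    by rewrite ler_wpM2r ?ler_expR// F0// (lev1 _ _ lx Sy).
  rewrite expRD mulrAC [leRHS](_ : _ = (expR (H * (r * u)) *
    (expR (Q * (r * u)) * F (s y))) * expR (psi (s y))); last by ring.
  rewrite ler_wpM2r ?expR_ge0// ler_wpM2l ?expR_ge0// FF//.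
  by rewrite ler_wpM2r ?F0 ?(lev1 _ _ lx')// ler_expR ler_pM2l.
have LF0 : 0 <= L F x'.
  by rewrite (ruelleE psi card) big_seq sumr_ge0// => y; rewrite (in_fibre card) => /eqP/term0.
(* This is where Q >= Qmin is used. *)
have bnd : (Q + H) * (r * u) + ln D%:R / b * u <= sigma * Q * u.
  rewrite mulrA -mulrDl ler_wpM2r// /sigma.
  have : 2 * (H + ln D%:R / b + 1) <= Q * (1 - r).
    by rewrite -ler_pdivrMr ?subr_gt0.
  have : H * r <= H by rewrite ler_piMr// ltW.
  lra.
have [sinj|] := pselect ({in fibre S x &, injective s}).
  rewrite (@le_trans _ _ (c * L F x'))//; last first.
    rewrite ler_wpM2r// ler_expR (le_trans _ bnd)// lerDl mulr_ge0//.
    by rewrite divr_ge0 ?ln_ge0 ?ler1n ?D_gt0// ltW// (exp_b sys).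
  rewrite !(ruelleE psi card) (@le_trans _ _ (\sum_(y <- fibre S x) c * term (s y)))//.
    by rewrite big_seq [leRHS]big_seq ler_sum// => y; rewrite (in_fibre card) => /eqP/termc.
  rewrite -mulr_sumr ler_wpM2l ?expR_ge0// (@ler_sum_inj _ _ _ (fibre S x') s term)//.
    by move=> y; rewrite !(in_fibre card) => /eqP/Hs[_ ->].
  by move=> y; rewrite (in_fibre card) => /eqP/term0.
move=> /existsNP[y1] /existsNP[y2] /not_implyP[+ /not_implyP[+ /not_implyP[s12 y12]]].
rewrite !(in_fibre card) => /eqP Sy1 /eqP Sy2.
have bu : b <= u.
  have [n1 S1] := Hs _ Sy1; have [n2 _] := Hs _ Sy2.
  rewrite /u -{1}Sy1 -S1.
  by apply: (exp_sep sys _ (etrans Sy1 (esym Sy2)) n1); [exact/eqP|rewrite s12].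
rewrite (@le_trans _ _ (D%:R * (c * L F x')))//; last first.
  rewrite mulrA ler_wpM2r// -[D%:R]lnK ?posrE ?ltr0n ?D_gt0//.
  rewrite -expRD ler_expR (le_trans _ bnd)// addrC lerD2l.
  rewrite -mulrA ler_peMr ?ln_ge0 ?ler1n ?D_gt0//.
  by rewrite mulrC ler_pdivlMr ?mul1r// (exp_b sys).
rewrite (ruelleE psi card) (@le_trans _ _ (\sum_(y <- fibre S x) (c * L F x')))//.
  rewrite big_seq [leRHS]big_seq ler_sum// => y; rewrite (in_fibre card) => /eqP Sy.
  rewrite (le_trans (termc _ Sy))// ler_wpM2l ?expR_ge0// (ruelleE psi card).
  have [_ /eqP sy] := Hs _ Sy.
  rewrite (big_fsetD1 (s y)) ?(in_fibre card)//= lerDl big_seq sumr_ge0// => z.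
  by rewrite !inE (in_fibre card) => /andP[_ /eqP/term0].
rewrite big_const_seq count_predT iter_addr_0 -[leLHS]mulr_natl.
rewrite ler_wpM2r ?mulr_ge0 ?expR_ge0// ler_nat.
by have /andP[] := card_fibre card x.
Qed.

Lemma lcone_le c c' n F : c <= c' -> lcone c n F -> lcone c' n F.
Proof.
move=> QQ' [F0 FQ]; split=> // x y lx xy; apply: le_trans (FQ x y lx xy) _.
by rewrite ler_wpM2r ?F0 ?(exp_near_lev sys xy)// ler_expR ler_wpM2r// (exp_t_ge0 sys).
Qed.

Lemma sigma_le : sigma * Q <= Q.
Proof.
by have /andP[_ /ltW s1] := sigma_lt1; rewrite ler_piMl ?(ltW Q0).
Qed.

Lemma lcone_iter n k F : lcone Q n F ->
  lcone Q (n + k%:Z) (iter k L F).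
Proof.
move=> FQ; elim: k => [|k IH]; first by rewrite addr0.
rewrite iterS -addn1 PoszD addrA; apply: lcone_le sigma_le _.
exact: ruelle_cone.
Qed.

Lemma lcone_iterS n k F : lcone Q n F ->
  lcone (sigma * Q) (n + k.+1%:Z) (iter k.+1 L F).
Proof.
move=> FQ; rewrite iterS -addn1 PoszD addrA.
by apply: ruelle_cone => //; exact: lcone_iter.
Qed.

(** Bound on the distortion of L^tau on the cone, see [lcone_harnack]. *)
Definition harnackC : R :=
  (D%:R * expR V) ^+ tau * (expR (Q * a) * expR V ^+ tau).

Local Notation K := harnackC.

(** By mixing, every z over x in tau steps is near some w over y in tau steps,
    so F z is controlled by F w, which is one of the terms of L^tau F y.  This
    bounds all terms of L^tau F x by a multiple of L^tau F y. *)
Lemma lcone_harnack n k F x y : lcone Q n F -> (tau <= k)%N ->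
  lev x = n + k%:Z -> lev y = n + k%:Z ->
  iter k L F x <= K * iter k L F y.
Proof.
move=> FQ /subnKC <- lx ly; rewrite iterD.
set m := (k - tau)%N in lx ly *.
have := lcone_iter m FQ; set G := iter m L F => -[G0 GQ].
have levG z w : lev w = n + (tau + m)%N%:Z -> iter tau S z = w -> lev z = n + m%:Z.
  move=> + zw; rewrite -zw lev_iter addnC PoszD addrA.
  by move=> /addIr.
have LG0 : 0 <= iter tau L G y.
  by apply: (iter_ruelle_ge0 psi card) => z /(levG _ _ ly); exact: G0.
set B := expR (Q * a) * expR V ^+ tau * iter tau L G y.
have GB z : iter tau S z = x -> G z <= B.
  move=> zx; have lz := levG _ _ lx zx.
  have [|w zw wy] := exp_mix sys (x := z) (w := y).
    by rewrite lz ly addnC PoszD addrA.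
  rewrite (le_trans (GQ z w lz zw))// /B -mulrA.
  rewrite ler_pM ?expR_ge0 ?G0 ?(levG _ _ ly wy)//.
    by rewrite ler_expR ler_pM2l// (exp_t_le sys zw).
  have := @iter_ruelle_ge _ _ _ _ _ _ card psi_le tau G w.
  rewrite wy => /(_ (fun z zy => G0 z (levG _ _ ly zy))).
  by rewrite expRN exprVn mulrC ler_pdivrMr ?exprn_gt0 ?expR_gt0// mulrC.
apply: (@le_trans _ _ (iter tau L (B \*o cst 1) x)).
  by apply: (le_iter_ruelle psi card) => z /GB; rewrite /= mulr1.
rewrite (iter_ruelleZ psi card)/= /harnackC -mulrA -/B mulrC.
rewrite ler_wpM2r ?(iter_ruelle1_le card psi_le)// /B.
by rewrite !mulr_ge0 ?exprn_ge0 ?expR_ge0.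
Qed.

(** Proportion of a function of the narrow cone that can be subtracted, see
    [lcone_sub_cst]. *)
Definition eta : R := (1 - sigma) * expR (- (Q * a)).

(** With u = t x y, the claim amounts to
    c (exp (Q u) - 1) <= F y (exp (Q u) - exp (sigma Q u)), and
    1 + v <= exp v bounds the first bracket above by Q u exp (Q a) and the second
    one below by (1 - sigma) Q u. *)
Lemma lcone_sub_cst n F c : lcone (sigma * Q) n F -> 0 <= c ->
  (forall x, lev x = n -> c <= eta * F x) -> lcone Q n (F \- cst c).
Proof.
move=> [F0 FQ] c0 cF.
have eta1 : eta <= 1.
  have /andP[/ltW s0 _] := sigma_lt1; rewrite /eta mulr_ile1 ?expR_ge0//.
  - by rewrite subr_ge0 ltW//; case/andP: sigma_lt1.
  - by rewrite gerBl.
  - by rewrite expR_le1 oppr_le0 mulr_ge0 ?(exp_a sys)// ltW.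
split=> [x lx|x y lx xy] /=.
  by rewrite subr_ge0 (le_trans (cF x lx))// ler_piMl// F0.
have ly : lev y = n by rewrite (exp_near_lev sys xy).
set u := t x y; have u0 : 0 <= u := exp_t_ge0 sys x y.
have ua : u <= a := exp_t_le sys xy.
have := FQ x y lx xy; rewrite -/u => FQxy.
have cFy := cF y ly; have Fy := F0 y ly.
set A := expR (Q * u); set B := expR (sigma * Q * u) in FQxy *.
have Qu : 0 <= Q * u by rewrite mulr_ge0// ltW.
have s1 : 0 <= 1 - sigma by rewrite subr_ge0 ltW//; case/andP: sigma_lt1.
have AB : (1 - sigma) * (Q * u) <= A - B.
  have -> : A = B * expR ((1 - sigma) * (Q * u)) by rewrite /A /B -expRD; congr expR; ring.
  have B1 : 1 <= B.
    by rewrite -expR0 ler_expR -mulrA mulr_ge0// ltW//; case/andP: sigma_lt1.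
  have := expR_ge1Dx ((1 - sigma) * (Q * u)).
  set w := expR _ => ww; rewrite -{2}[B]mulr1 -mulrBr.
  have w0 : 0 <= w - 1 by rewrite subr_ge0 (le_trans _ ww)// lerDl mulr_ge0.
  by rewrite (@le_trans _ _ (w - 1)) ?ler_peMl// lerBrDl.
have A1 : A - 1 <= Q * u * expR (Q * a).
  rewrite (@le_trans _ _ (Q * u * A))//.
    have := expR_ge1Dx (- (Q * u)); rewrite expRN -/A.
    rewrite -(@ler_pM2r _ A) ?expR_gt0// mulVf ?gt_eqF ?expR_gt0//; lra.
  by rewrite ler_wpM2l// ler_expR ler_pM2l.
have key : c * (A - 1) <= F y * (A - B).
  rewrite (@le_trans _ _ (eta * F y * (Q * u * expR (Q * a))))//.
    rewrite ler_pM// subr_ge0 -expR0 ler_expR//.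
  rewrite (_ : _ * _ * _ = F y * ((1 - sigma) * (Q * u))); last first.
    rewrite /eta expRN; field; exact: lt0r_neq0 (expR_gt0 _).
  by rewrite ler_wpM2l.
lra.
Qed.

Lemma lcone_cst n c : 0 <= c -> lcone Q n (cst c).
Proof.
move=> c0; split=> // x y _ _; rewrite ler_peMl// -expR0 ler_expR.
rewrite mulr_ge0 ?(exp_t_ge0 sys)//.
exact: ltW Q0.
Qed.

Lemma lcone_scale n c F : 0 <= c -> lcone Q n F ->
  lcone Q n (c \*o F).
Proof.
move=> c0 [F0 FQ]; split=> [x lx|x y lx xy] /=; first by rewrite mulr_ge0// F0.
by rewrite mulrCA ler_wpM2l// FQ.
Qed.

Lemma harnackC_ge1 : 1 <= K.
Proof.
have := lcone_harnack (@lcone_cst 0 1 ler01) (leqnn tau)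
  (lev_pt (0 + tau%:Z)) (lev_pt (0 + tau%:Z)).
by rewrite ler_pMl// (iter_ruelle1_gt0 psi card).
Qed.

(** * Exponential loss of memory *)

(** In tau + 1 steps the images of two functions of the cone acquire a common
    constant part that is worth the proportion [mixing_mass] of their value.
    The rate is chosen such that rate^(tau + 1) >= 1 - mixing_mass by the
    inequality of Bernoulli. *)
Definition mixing_mass : R := eta / K.
Definition rate : R := 1 - mixing_mass / tau.+1%:R.
Definition contractionC : R := K / rate ^+ (tau + tau.+1).

Let K0 : 0 < K := lt_le_trans ltr01 harnackC_ge1.

Lemma mixing_mass_itv : 0 < mixing_mass < 1.
Proof.
have /andP[s0 s1] := sigma_lt1.
have e0 : 0 < eta by rewrite /eta mulr_gt0 ?expR_gt0 ?subr_gt0.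
rewrite /mixing_mass divr_gt0//= ltr_pdivrMr// mul1r (lt_le_trans _ harnackC_ge1)//.
rewrite /eta (@le_lt_trans _ _ (1 - sigma))//; last by rewrite gtrBl.
rewrite ler_piMr ?subr_ge0 ?(ltW s1)// expR_le1 oppr_le0.
by rewrite mulr_ge0 ?(exp_a sys)// ltW.
Qed.

Lemma rate_itv : 0 < rate < 1.
Proof.
have /andP[m0 m1] := mixing_mass_itv.
rewrite /rate subr_gt0 gtrBl divr_gt0// andbT ltr_pdivrMr// mul1r.
by rewrite (lt_le_trans m1)// ler1n.
Qed.

Let g0 : 0 < rate. Proof. by case/andP: rate_itv. Qed.
Let gle1 : rate <= 1. Proof. by case/andP: rate_itv => _ /ltW. Qed.

Lemma contractionC_gt0 : 0 < contractionC.
Proof. by rewrite divr_gt0// exprn_gt0. Qed.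

(** Induction on k by steps of tau + 1.  The constant c is the proportion
    [mixing_mass] of the common value at y, divided by the factor by which the
    remaining iterations multiply a constant at y; it can be subtracted from
    both images because of [lcone_harnack] and [lcone_sub_cst]. *)
Lemma contraction k n F G x y : lcone Q n F -> lcone Q n G ->
  (tau <= k)%N -> lev x = n + k%:Z -> lev y = n + k%:Z ->
  iter k L F y = iter k L G y ->
  iter k L F x - iter k L G x <= contractionC * rate ^+ k * iter k L F y.
Proof.
elim/ltn_ind: k n F G => k IH n F G FQ GQ tk lx ly Fy.
have pos F' z m : lcone Q n F' -> lev z = n + m%:Z -> 0 <= iter m L F' z.
  by move=> /(@lcone_iter _ m _)[+ _] => /[apply].
(* Below this time rate^k is at least rate^(tau + tau + 1), which the constant
   contractionC compensates, so that the Harnack inequality suffices. *)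
have [kl|kg] := ltnP k (tau + tau.+1).
  rewrite (@le_trans _ _ (iter k L F x)) ?gerBl ?pos//.
  rewrite (le_trans (lcone_harnack FQ tk lx ly))// ler_wpM2r ?pos//.
  rewrite /contractionC mulrAC ler_pdivlMr ?exprn_gt0// ler_wpM2l ?(ltW K0)//.
  by rewrite ler_wiXn2l ?(ltW g0)// ltnW.
have kM : (tau.+1 <= k)%N by rewrite (leq_trans _ kg)// leq_addl.
set m := (k - tau.+1)%N; have km : k = (m + tau.+1)%N by rewrite subnK.
have tm : (tau <= m)%N by rewrite leq_subRL// addnC.
have lxm z : lev z = n + k%:Z -> lev z = n + tau.+1%:Z + m%:Z.
  by rewrite km addnC PoszD addrA.
set F1 := iter tau.+1 L F; set G1 := iter tau.+1 L G.
have FE : iter k L F = iter m L F1 by rewrite km iterD.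
have GE : iter k L G = iter m L G1 by rewrite km iterD.
set Wy := iter m L (cst 1) y; have Wy0 : 0 < Wy := iter_ruelle1_gt0 psi card m y.
set c := mixing_mass * (iter k L F y / Wy).
have /andP[m0 m1] := mixing_mass_itv.
have c0 : 0 <= c by rewrite mulr_ge0 ?(ltW m0)// divr_ge0 ?(ltW Wy0) ?pos.
have cle F' : lcone Q n F' -> iter k L F' y = iter k L F y ->
    forall z, lev z = n + tau.+1%:Z -> c <= eta * iter tau.+1 L F' z.
  move=> FQ' F'y z lz; rewrite /c -F'y km iterD.
  have -> : eta * iter tau.+1 L F' z =
      mixing_mass * (K * iter tau.+1 L F' z).
    by rewrite /mixing_mass mulrA divfK// gt_eqF.
  rewrite ler_wpM2l ?(ltW m0)// ler_pdivrMr//.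
  have := iter_ruelleZ psi card m (K * iter tau.+1 L F' z) (cst 1).
  move=> /(congr1 (@^~ y)) /= <-; apply: (le_iter_ruelle psi card) => w wy.
  rewrite /= mulr1; apply: (lcone_harnack FQ' (leqnSn tau)) => //.
  by apply: (@addIr _ m%:Z); rewrite -(lev_iter m w) wy lxm.
have sub F' : lcone Q n F' -> iter k L F' y = iter k L F y ->
    lcone Q (n + tau.+1%:Z) (iter tau.+1 L F' \- cst c).
  move=> FQ' F'y; apply: lcone_sub_cst => //; last exact: cle.
  exact: (lcone_iterS).
have c1 : cst c = c \*o cst 1 :> (E -> R) by apply/funext => z /=; rewrite mulr1.
have subE F' z : iter m L (iter tau.+1 L F' \- cst c) z =
    iter k L F' z - c * iter m L (cst 1) z.
  by rewrite (iter_ruelleB psi card) c1 (iter_ruelleZ psi card)/= km iterD.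
have mk : (m < k)%N by rewrite km -addn1 leq_add2l.
have := IH m mk _ _ _ (sub F FQ erefl) (sub G GQ (esym Fy)) tm (lxm _ lx) (lxm _ ly).
rewrite !subE Fy => /(_ erefl); rewrite opprB addrA subrK => /le_trans; apply.
rewrite -mulrA -[leRHS]mulrA ler_wpM2l ?(ltW contractionC_gt0)//.
rewrite km exprD -mulrA ler_wpM2l ?exprn_ge0 ?(ltW g0)// -km.
rewrite /c -/Wy mulrA divfK ?gt_eqF// Fy -[X in X - _]mul1r -mulrBl.
rewrite ler_wpM2r ?pos//.
have := @bernoulli_le _ (mixing_mass / tau.+1%:R) tau.+1.
rewrite [tau.+1%:R * _]mulrC divfK ?pnatr_eq0//; apply.
by rewrite divr_ge0 ?(ltW m0)//= ler_pdivrMr// mul1r (le_trans (ltW m1))// ler1n.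
Qed.

Definition crossC : R := contractionC * K.

Lemma crossC_gt0 : 0 < crossC.
Proof. by rewrite mulr_gt0 ?contractionC_gt0. Qed.

(** [contraction] applied to the multiples of F and G by L^k G y and L^k F y,
    whose images agree at y. *)
Lemma cross_ratio k n F G x y :
  lcone Q n F -> lcone Q n G ->
  (tau <= k)%N -> lev x = n + k%:Z -> lev y = n + k%:Z ->
  iter k L F x * iter k L G y <=
  (1 + crossC * rate ^+ k) * (iter k L F y * iter k L G x).
Proof.
move=> FQ GQ tk lx ly.
have pos F' z : lcone Q n F' -> lev z = n + k%:Z -> 0 <= iter k L F' z.
  by move=> /(@lcone_iter _ k _)[+ _] => /[apply].
have := @contraction k n (iter k L G y \*o F) (iter k L F y \*o G) x y
  (lcone_scale (pos _ _ GQ ly) FQ) (lcone_scale (pos _ _ FQ ly) GQ) tk lx ly.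
rewrite !(iter_ruelleZ psi card)/= => /(_ (mulrC _ _)).
have GK := lcone_harnack GQ tk ly lx.
rewrite lerBlDl mulrDl mul1r mulrC => /le_trans; apply; rewrite lerD2l.
rewrite /crossC [contractionC * K * _]mulrAC -[leRHS]mulrA ler_wpM2l//.
  by rewrite mulr_ge0 ?exprn_ge0 ?(ltW g0)// ltW// contractionC_gt0.
by rewrite mulrC [leRHS]mulrCA ler_wpM2l// pos.
Qed.

Local Notation C := crossC.

Let C0 : 0 < C := crossC_gt0.
Let g01 : 0 < rate < 1 := rate_itv.
Let e0 k : 0 <= C * rate ^+ k. Proof. by rewrite mulr_ge0 ?exprn_ge0 ?ltW. Qed.
Let cone1 n : lcone Q n (cst 1) := lcone_cst n ler01.

Let cone_ge0 n k F x : lcone Q n F -> lev x = n + k%:Z -> 0 <= iter k L F x.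
Proof. by move=> FQ lx; have [+ _] := lcone_iter k FQ; exact. Qed.

(** * Means and eigenfunctions *)

Lemma le0_geometric A B : (forall k, (tau <= k)%N -> A <= B * rate ^+ k) -> A <= 0.
Proof.
move=> AB; apply/ler_addgt0Pr => e e1; rewrite add0r.
have g01' : 0 <= rate < 1 by case/andP: g01 => /ltW -> ->.
by have [k tk ke] := geometric_le B g01' e1 tau; exact: le_trans (AB k tk) ke.
Qed.

(** By [cross_ratio] with G = 1 the oscillation of L^k F / L^k 1 is small
    relative to the ratio itself, which is bounded by its values B at time
    tau. *)
Lemma lcone_meanable n F : lcone Q n F -> meanable n F.
Proof.
move=> FQ; apply: (tends_mean) => e e1.
set y0 := pt (n + tau%:Z); have ly0 : lev y0 = n + tau%:Z := lev_pt _.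
pose B := K * K * iter tau L F y0 / W tau y0.
have FB k x : (tau <= k)%N -> lev x = n + k%:Z -> iter k L F x <= B * W k x.
  move=> tk lx; apply: (le_iterW tk) lx => z lz.
  rewrite (le_trans (lcone_harnack FQ (leqnn _) lz ly0))//.
  have WK := lcone_harnack (cone1 n) (leqnn _) ly0 lz.
  rewrite /B [leRHS]mulrAC ler_pdivlMr//.
  have -> : K * K * iter tau L F y0 * W tau z =
    K * iter tau L F y0 * (K * W tau z) by ring.
  by rewrite ler_wpM2l// mulr_ge0 ?(ltW K0)// (cone_ge0 FQ).
have g01' : 0 <= rate < 1 by case/andP: g01 => /ltW -> ->.
have [k tk ke] := geometric_le (C * B) g01' e1 tau.
have ly := lev_pt (n + k%:Z); set y := pt _ in ly.
exists k, (iter k L F y / W k y) => x lx.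
set c := _ / _; have cW : iter k L F y = c * W k y by rewrite /c divfK// gt_eqF.
have cB : c <= B by rewrite ler_pdivrMr// FB.
set w := W k x; set f := iter k L F x.
have w0 : 0 < w := W0 k x.
have up : f <= (1 + C * rate ^+ k) * (c * w).
  have := cross_ratio FQ (cone1 n) tk lx ly.
  rewrite cW -/w -/f => h1; rewrite -(ler_pM2r (W0 k y)) (le_trans h1)//.
  by rewrite le_eqVlt; apply/orP; left; apply/eqP; ring.
have lo : c * w <= (1 + C * rate ^+ k) * f.
  have := cross_ratio (cone1 n) FQ tk lx ly.
  rewrite cW -/w -/f => h1; rewrite -(ler_pM2r (W0 k y)).
  rewrite (le_trans _ (le_trans h1 _))// le_eqVlt; apply/orP; left; apply/eqP; ring.
have sml z : z <= B * w -> C * rate ^+ k * z <= e * w.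
  move=> zB; rewrite (le_trans (ler_wpM2l (e0 k) zB))// mulrA ler_wpM2r ?(ltW w0)//.
  by rewrite mulrAC.
rewrite ler_norml; rewrite !mulrDl !mul1r in up lo.
have := sml f (FB k x tk lx); have := sml (c * w) (ler_wpM2r (ltW w0) cB).
by move=> h1 h2; apply/andP; split; lra.
Qed.

Let cone_meanable n F (FQ : lcone Q n F) : meanable n F := lcone_meanable FQ.

Lemma lcone_ruelle n F : lcone Q n F -> lcone Q (n + 1) (L F).
Proof. exact: (@lcone_iter _ 1). Qed.

Lemma meanable_ruelle1 n : meanable (n + 1) (L (cst 1)).
Proof. exact/lcone_meanable/lcone_ruelle. Qed.

Lemma lambda_gt0 n : 0 < lambda n.
Proof.
have /andP[+ _] := lambda_bounds (meanable_ruelle1 n).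
exact/lt_le_trans/expR_gt0.
Qed.

Lemma lprod_gt0 n k : 0 < lprod lambda n k.
Proof. by rewrite /lprod; apply: prodr_gt0 => i _; exact: lambda_gt0. Qed.

Lemma mean_iterE n k F : lcone Q n F ->
  mean (n + k%:Z) (iter k L F) = lprod lambda n k * mean n F.
Proof.
by move=> FQ; have [] := mean_iter k meanable_ruelle1 (cone_meanable FQ).
Qed.

Lemma mean_iter1 n k : mean (n + k%:Z) (W k) = lprod lambda n k.
Proof. by rewrite mean_iterE// (mean1) mulr1. Qed.

Lemma mean_ge n F c : meanable n F -> (forall x, lev x = n -> c <= F x) ->
  c <= mean n F.
Proof.
move=> Fm cF; rewrite -[leLHS]mulr1 -(mean1 n).
rewrite -(meanZ _ (cone_meanable (cone1 n))) -[leRHS]addr0.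
apply: le_mean => //; first exact: (meanableZ _ (cone_meanable (cone1 n))).
by move=> x lx; rewrite /= mulr1 addr0 cF.
Qed.

Lemma mean_le n F c : meanable n F -> (forall x, lev x = n -> F x <= c) ->
  mean n F <= c.
Proof.
move=> Fm cF; rewrite -[leRHS]mulr1 -(mean1 n).
rewrite -(meanZ _ (cone_meanable (cone1 n))) -[leRHS]addr0.
apply: le_mean => //; first exact: (meanableZ _ (cone_meanable (cone1 n))).
by move=> x lx; rewrite /= mulr1 addr0 cF.
Qed.

(** Positivity at z spreads in tau steps to a positive lower bound on the whole
    level, by [lcone_harnack]. *)
Lemma mean_gt0 n F z : lcone Q n F -> lev z = n -> 0 < F z -> 0 < mean n F.
Proof.
move=> FQ lz Fz; rewrite -(pmulr_rgt0 _ (lprod_gt0 n tau)) -mean_iterE//.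
set w := iter tau S z; have lw : lev w = n + tau%:Z by rewrite lev_iter lz.
have Fw : 0 < iter tau L F w.
  rewrite (lt_le_trans _ (iter_ruelle_ge card psi_le (k := tau) (F := F) (y := z) _))//.
    by rewrite mulr_gt0 ?exprn_gt0 ?expR_gt0.
  move=> y yw; apply: (FQ.1); apply: (@addIr _ tau%:Z).
  by rewrite -lev_iter yw.
rewrite (lt_le_trans (divr_gt0 Fw K0))// mean_ge//.
  exact/lcone_meanable/lcone_iter.
by move=> x lx; rewrite ler_pdivrMr// mulrC (lcone_harnack FQ).
Qed.

(** [cross_ratio] averaged over y. *)
Lemma mean_cross n k F G x : lcone Q n F -> lcone Q n G -> (tau <= k)%N ->
  lev x = n + k%:Z ->
  iter k L F x * mean (n + k%:Z) (iter k L G) <=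
  (1 + C * rate ^+ k) * (mean (n + k%:Z) (iter k L F) * iter k L G x).
Proof.
move=> FQ GQ tk lx.
have Fm : meanable (n + k%:Z) (iter k L F) by exact/lcone_meanable/lcone_iter.
have Gm : meanable (n + k%:Z) (iter k L G) by exact/lcone_meanable/lcone_iter.
rewrite mulrA [_ * mean _ (iter k L F)]mulrC -mulrA [leRHS]mulrC.
rewrite -!(meanZ)// -[leRHS]addr0.
apply: (le_mean); [exact: (meanableZ)..|].
move=> y ly; rewrite /= addr0 -mulrA [iter k L G x * _]mulrC.
exact: (cross_ratio FQ GQ tk lx ly).
Qed.

Lemma iter_le_mean n k F x : lcone Q n F -> (tau <= k)%N -> lev x = n + k%:Z ->
  iter k L F x <= (1 + C * rate ^+ k) * (mean n F * W k x).
Proof.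
move=> FQ tk lx; have := mean_cross FQ (cone1 n) tk lx.
rewrite mean_iter1 mean_iterE// => h1; rewrite -(ler_pM2r (lprod_gt0 n k)).
rewrite (le_trans h1)// le_eqVlt; apply/orP; left; apply/eqP; ring.
Qed.

Lemma mean_le_iter n k F x : lcone Q n F -> (tau <= k)%N -> lev x = n + k%:Z ->
  mean n F * W k x <= (1 + C * rate ^+ k) * iter k L F x.
Proof.
move=> FQ tk lx; have := mean_cross (cone1 n) FQ tk lx.
rewrite mean_iter1 mean_iterE// => h1; rewrite -(ler_pM2r (lprod_gt0 n k)).
rewrite (le_trans _ (le_trans h1 _))// le_eqVlt; apply/orP; left; apply/eqP; ring.
Qed.

(** The functional at the level of x normalizes, so this is the image of F
    under k steps, scaled to have mean 1 at every level. *)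
Definition normalize k F x : R := iter k L F x / mean (lev x) (iter k L F).

Lemma mean_iter_gt0 n k F : lcone Q n F -> 0 < mean n F ->
  0 < mean (n + k%:Z) (iter k L F).
Proof. by move=> FQ Fp; rewrite mean_iterE// mulr_gt0// lprod_gt0. Qed.

Lemma normalize_bounds n k F x : lcone Q n F -> 0 < mean n F -> (tau <= k)%N ->
  lev x = n + k%:Z -> K^-1 <= normalize k F x <= K.
Proof.
move=> FQ Fp tk lx; have mF := mean_iter_gt0 k FQ Fp; rewrite /normalize lx.
have Fm : meanable (n + k%:Z) (iter k L F) by exact/lcone_meanable/lcone_iter.
rewrite ler_pdivlMr// ler_pdivrMr// mulrC ler_pdivrMr//; apply/andP; split.
  by apply: mean_le => // y ly; rewrite mulrC (lcone_harnack FQ).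
rewrite mulrC -ler_pdivrMr//; apply: mean_ge => // y ly.
by rewrite ler_pdivrMr// mulrC (lcone_harnack FQ).
Qed.

Lemma normalize_dist n k F G x : lcone Q n F -> 0 < mean n F ->
  lcone Q n G -> 0 < mean n G -> (tau <= k)%N -> lev x = n + k%:Z ->
  `|normalize k F x - normalize k G x| <= C * K * rate ^+ k.
Proof.
move=> + + + + tk lx; wlog : F G / normalize k G x <= normalize k F x.
  move=> WH FQ Fp GQ Gp; have [|/ltW] := leP (normalize k G x) (normalize k F x).
    by move=> /WH; apply.
  by rewrite distrC => /WH; apply.
move=> GF FQ Fp GQ Gp; rewrite ger0_norm ?subr_ge0//.
have /andP[_ GK] := normalize_bounds GQ Gp tk lx.
have mF := mean_iter_gt0 k FQ Fp; have mG := mean_iter_gt0 k GQ Gp.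
have := mean_cross FQ GQ tk lx; rewrite mulrCA => h1.
have : normalize k F x <= (1 + C * rate ^+ k) * normalize k G x.
  rewrite /normalize lx ler_pdivrMr// mulrA mulrAC ler_pdivlMr// (le_trans h1)//.
  rewrite le_eqVlt; apply/orP; left; apply/eqP; ring.
rewrite mulrDl mul1r -lerBlDl => /le_trans; apply.
by rewrite [leRHS]mulrAC ler_wpM2l.
Qed.

(** The limit is taken from the constant function 1 started k levels below x;
    [eigenfun_dist] shows that every function of the cone gives the same
    limit. *)
Definition eigenfun x : R := lim ((fun k => normalize k (cst 1) x) @ \oo).

(** For j >= k the image of 1 under j steps is the image under k steps of a
    function of the cone at level n. *)
Lemma normalize1_dist n k F x j : lcone Q n F -> 0 < mean n F -> (tau <= k)%N ->
  lev x = n + k%:Z -> (k <= j)%N ->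
  `|normalize j (cst 1) x - normalize k F x| <= C * K * rate ^+ k.
Proof.
move=> FQ Fp tk lx kj.
have nE : n = n + k%:Z - j%:Z + (j - k)%N%:Z.
  by rewrite -subzn// addrA subrK addrK.
have c1 : lcone Q n (W (j - k)).
  by rewrite nE; exact: lcone_iter.
have m1 : 0 < mean n (W (j - k)).
  by rewrite nE mean_iter1 lprod_gt0.
rewrite (_ : normalize j _ x = normalize k (W (j - k)) x).
  exact: (normalize_dist c1 m1 FQ Fp tk lx).
by rewrite /normalize -iterD subnKC.
Qed.

Lemma eigenfun_cvg x : normalize k (cst 1) x @[k --> \oo] --> eigenfun x.
Proof.
apply: cauchy_cvg; apply: cauchy_exP => e e1.
have g01' : 0 <= rate < 1 by case/andP: g01 => /ltW -> ->.
have [k tk ke] := geometric_le (C * K) g01' (divr_gt0 e1 (ltr0n _ 2)) tau.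
exists (normalize k (cst 1) x), k => // j /= kj.
rewrite /ball/= distrC.
rewrite (le_lt_trans (@normalize1_dist (lev x - k%:Z) k (cst 1) x j _ _ _ _ _))//.
- by rewrite (mean1).
- by rewrite subrK.
- by rewrite (le_lt_trans ke)// ltr_pdivrMr// ltr_pMr// ltr1n.
Qed.

Lemma eigenfun_dist n k F x : lcone Q n F -> 0 < mean n F -> (tau <= k)%N ->
  lev x = n + k%:Z -> `|eigenfun x - normalize k F x| <= C * K * rate ^+ k.
Proof.
move=> FQ Fp tk lx; apply/ler_addgt0Pr => e e1.
have /cvgrPdist_le/(_ e e1)[N _ NP] := @eigenfun_cvg x.
have := NP (maxn N k) (leq_maxl _ _).
have := @normalize1_dist n k F x _ FQ Fp tk lx (leq_maxr N k).
set u := normalize (maxn N k) _ _ => h1 h2.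
by rewrite (le_trans (ler_distD u _ _))// addrC lerD.
Qed.

Lemma eigenfun_dist1 n k x : (tau <= k)%N -> lev x = n + k%:Z ->
  `|eigenfun x - normalize k (cst 1) x| <= C * K * rate ^+ k.
Proof. by move=> tk lx; apply: eigenfun_dist lx; rewrite ?(mean1). Qed.

Lemma eigenfun_ge x : K^-1 <= eigenfun x.
Proof.
rewrite -subr_le0; apply: (@le0_geometric _ (C * K)) => k tk.
have lx : lev x = lev x - k%:Z + k%:Z by rewrite subrK.
have := eigenfun_dist1 tk lx; rewrite ler_norml => /andP[h1 h2].
have m1 : 0 < mean (lev x - k%:Z) (cst 1) by rewrite (mean1).
have /andP[+ _] := normalize_bounds (cone1 _) m1 tk lx; lra.
Qed.

Lemma eigenfun_gt0 x : 0 < eigenfun x.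
Proof. by rewrite (lt_le_trans _ (eigenfun_ge x))// invr_gt0. Qed.

(** The cone is defined by inequalities that pass to the limit. *)
Lemma eigenfun_cone n : lcone Q n eigenfun.
Proof.
split=> [x _|x y lx xy]; first exact/ltW/eigenfun_gt0.
set q := expR _; have q0 : 0 <= q := expR_ge0 _.
rewrite -subr_le0; apply: (@le0_geometric _ (C * K + q * (C * K))) => k tk.
have lx' : lev x = n - k%:Z + k%:Z by rewrite subrK.
have ly' : lev y = n - k%:Z + k%:Z by rewrite (exp_near_lev sys xy).
have := eigenfun_dist1 tk lx'; have := eigenfun_dist1 tk ly'.
have := (lcone_iter k (cone1 (n - k%:Z))).2 x y lx' xy; rewrite -/q.
set u := normalize k _ x; set v := normalize k _ y => h1.
have uv : u <= q * v.
  rewrite /u /v /normalize (exp_near_lev sys xy) mulrA ler_wpM2r// invr_ge0 ltW//.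
  by rewrite lx' mean_iter1 lprod_gt0.
rewrite (_ : (_ + _) * _ = C * K * rate ^+ k + q * (C * K * rate ^+ k)); last by ring.
set B := C * K * rate ^+ k; rewrite !ler_norml => /andP[h2 h3] /andP[h4 h5].
have : q * (v - eigenfun y) <= q * B by rewrite ler_wpM2l//; lra.
by rewrite mulrBr; lra.
Qed.

Lemma eigenfun_level n k y : (tau <= k)%N -> lev y = n + k%:Z ->
  `|eigenfun y - ((lprod lambda n k)^-1 \*o W k) y| <= C * K * rate ^+ k.
Proof.
move=> tk ly; have := eigenfun_dist1 tk ly.
by rewrite /normalize ly mean_iter1 /= [_^-1 * _]mulrC.
Qed.

Let U n k := (lprod lambda (n - k%:Z) k)^-1 \*o W k.

Let U_meanable n k : meanable n (U n k).
Proof.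
apply: (meanableZ); rewrite -{1}[n](subrK k%:Z).
exact/lcone_meanable/lcone_iter.
Qed.

Let mean_U n k : mean n (U n k) = 1.
Proof.
have m1 : meanable n (W k).
  rewrite -[n](subrK k%:Z); exact/lcone_meanable/lcone_iter.
rewrite (meanZ)// -{2}[n](subrK k%:Z) mean_iter1.
by rewrite mulVf// gt_eqF// lprod_gt0.
Qed.

Let U_dist n k : (tau <= k)%N -> forall y, lev y = n ->
  `|eigenfun y - U n k y| <= C * K * rate ^+ k.
Proof. by move=> tk y ly; apply: eigenfun_level => //; rewrite subrK. Qed.

Lemma mean_eigenfun n : mean n eigenfun = 1.
Proof.
have hm : meanable n eigenfun by exact/lcone_meanable/eigenfun_cone.
apply/eqP; rewrite eq_le -subr_le0 -[X in _ && X]subr_le0.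
apply/andP; split; apply: (@le0_geometric _ (C * K)) => k tk.
  rewrite lerBlDl -(mean_U n k); apply: le_mean => // y ly.
  by have := U_dist tk ly; rewrite ler_norml => /andP[]; lra.
rewrite lerBlDl -(mean_U n k); apply: le_mean => // y ly.
by have := U_dist tk ly; rewrite ler_norml => /andP[]; lra.
Qed.

(** L maps the k-th normalized image U n k to lambda n times the next one. *)
Lemma ruelle_eigenfun n x : lev x = n + 1 ->
  L eigenfun x = lambda n * eigenfun x.
Proof.
move=> lx; have L1 : 0 < L (cst 1) x := W0 1 x.
have l0 := lambda_gt0 n.
apply/eqP; rewrite -subr_eq0 -normr_le0.
apply: (@le0_geometric _ (C * K * L (cst 1) x + lambda n * (C * K))) => k tk.
set B := C * K * rate ^+ k.
have h1 : `|L eigenfun x - L (U n k) x| <= B * L (cst 1) x.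
  have BE : B * L (cst 1) x = iter 1 L (B \*o cst 1) x by rewrite (iter_ruelleZ psi card).
  rewrite BE ler_norml lerNl opprB !lerBlDl.
  rewrite -![ruelle S psi _ x]/(iter 1 L _ x) -/((_ \+ _) x).
  rewrite -[X in X && _]/(iter 1 L (U n k) x <=
    (iter 1 L eigenfun \+ iter 1 L (B \*o cst 1)) x).
  rewrite -[X in _ && X]/(iter 1 L eigenfun x <=
    (iter 1 L (U n k) \+ iter 1 L (B \*o cst 1)) x).
  rewrite -!(iter_ruelleD psi card); apply/andP; split;
    apply: (le_ruelle_lev _ lx) => y /(U_dist tk);
    rewrite ler_norml /= mulr1 => /andP[]; rewrite -/B; lra.
have h2 : L (U n k) x = lambda n * U (n + 1) k.+1 x.
  have /(congr1 (@^~ x))/= -> := iter_ruelleZ psi card 1 (lprod lambda (n - k%:Z) k)^-1 (W k).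
  rewrite /U/= (_ : n + 1 - _ = n - k%:Z); last by rewrite -add1n PoszD addrKA.
  rewrite /lprod big_ord_recr/= subrK.
  by rewrite invfM [X in _ = _ * (X * _)]mulrC -mulrA mulVKf ?gt_eqF.
have h3 : `|eigenfun x - U (n + 1) k.+1 x| <= B.
  apply: le_trans (U_dist (leqW tk) lx) _; apply: ler_wpM2l.
    by rewrite mulr_ge0// ltW.
  by rewrite exprS ler_piMl ?exprn_ge0 ?(ltW g0)//; case/andP: g01 => _ /ltW.
rewrite (le_trans (ler_distD (L (U n k) x) _ _))// h2 -mulrBr normrM gtr0_norm//.
rewrite mulrDl lerD//; first by rewrite -h2 (le_trans h1)// /B mulrAC.
by rewrite -mulrA distrC ler_wpM2l// ltW.
Qed.

(** A normalized eigenfunction is equal to its normalized images, because its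
    eigenvalues cancel in the normalization. *)
Lemma eigenfun_uniq F : (forall n, lcone Q n F) -> (forall n, mean n F = 1) ->
  (forall n, exists c, forall x, lev x = n + 1 -> L F x = c * F x) ->
  F = eigenfun.
Proof.
move=> FQ F1 FL; apply/funext => x; apply/eqP; rewrite eq_sym -subr_eq0 -normr_le0.
apply: (@le0_geometric _ (C * K)) => k tk.
have Fp n : 0 < mean n F by rewrite F1.
have lx : lev x = lev x - k%:Z + k%:Z by rewrite subrK.
suff {1}-> : F x = normalize k F x by exact: eigenfun_dist (FQ _) (Fp _) tk lx.
have [c cF] : exists c, forall y, lev y = lev x -> iter k L F y = c * F y.
  rewrite {1}lx; move: (lev x - k%:Z) => n; elim: k {tk lx} => [|k [c IH]].
    by exists 1 => y _; rewrite mul1r.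
  have [d dF] := FL (n + k%:Z); exists (c * d) => y; rewrite -shiftS => ly.
  rewrite -mulrA -dF// iterS -[L F y]/(iter 1 L F y).
  have /(congr1 (@^~ y))/= <- := iter_ruelleZ psi card 1 c F.
  exact: (eq_ruelle_lev (k := 1) IH).
have mF : mean (lev x) (iter k L F) = c.
  rewrite (eq_mean (G := c \*o F))// (meanZ) ?F1 ?mulr1//.
  exact: lcone_meanable.
have := mean_iter_gt0 k (FQ (lev x - k%:Z)) (Fp _); rewrite -lx mF => c0.
by rewrite /normalize mF cF// mulrC mulKf// gt_eqF.
Qed.

End expanding_dynamics.

(** * Lipschitz approximation on a compact metric space *)

Section lipschitz_envelope.
Context {R : realType} {X : pmetricType R}.
Implicit Types (f g : X -> R) (x y : X) (N : nat) (c : R).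

Definition lipschitz N f := forall x y, f x <= f y + N%:R * mdist x y.

Lemma lipschitz_continuous N f : lipschitz N f -> continuous f.
Proof.
move=> fN x; apply/cvgrPdist_le => e e0.
have N0 : 0 < e / N.+1%:R by rewrite divr_gt0.
near=> y; have xy : mdist x y <= e / N.+1%:R.
  near: y; have := nbhsx_ballx x _ N0; rewrite ballEmdist; apply: filterS.
  by move=> y /ltW.
have := fN x y; have := fN y x; rewrite (metric_sym y x).
have : N%:R * mdist x y <= e.
  rewrite (@le_trans _ _ (N.+1%:R * mdist x y)) ?ler_wpM2r ?mdist_ge0 ?ler_nat//.
  by rewrite mulrC -ler_pdivlMr.
by move=> h1 h2 h3; rewrite ler_norml; apply/andP; split; lra.
Unshelve. all: by end_near. Qed.

(** The largest N-Lipschitz function below f, that is the infimal convolution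
    of f with N times the distance. *)
Definition envelope N f x : R := inf (range (fun y => f y + N%:R * mdist x y)).

Lemma envelope_ge N f c x : (forall y, c <= f y) -> c <= envelope N f x.
Proof.
move=> cf; apply: lb_le_inf; first by exists (f x + N%:R * mdist x x); exists x.
by move=> _ [y _ <-]; rewrite (le_trans (cf y))// lerDl mulr_ge0// mdist_ge0.
Qed.

Lemma envelope_le N f c x y : (forall y, c <= f y) ->
  envelope N f x <= f y + N%:R * mdist x y.
Proof.
move=> cf; apply: inf_lbound; last by exists y.
exists c => _ [z _ <-]; rewrite (le_trans (cf z))// lerDl.
by rewrite mulr_ge0// mdist_ge0.
Qed.

Lemma envelope_lipschitz N f c : (forall y, c <= f y) -> lipschitz N (envelope N f).
Proof.
move=> cf x y; rewrite -lerBlDr; apply: lb_le_inf.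
  by exists (f y + N%:R * mdist y y); exists y.
move=> _ [z _ <-]; rewrite lerBlDr (le_trans (envelope_le N x z cf))//.
rewrite -addrA lerD2l -mulrDr ler_wpM2l// addrC; exact: metric_triangle.
Qed.

Lemma envelope_continuous N f c : (forall y, c <= f y) -> continuous (envelope N f).
Proof. by move=> /envelope_lipschitz/lipschitz_continuous. Qed.

Lemma envelope_le_fun N f c x : (forall y, c <= f y) -> envelope N f x <= f x.
Proof. by move=> cf; have := envelope_le N x x cf; rewrite mdistxx mulr0 addr0. Qed.

Lemma envelope_homo N N' f c x : (forall y, c <= f y) -> (N <= N')%N ->
  envelope N f x <= envelope N' f x.
Proof.
move=> cf NN; apply: lb_le_inf; first by exists (f x + N'%:R * mdist x x); exists x.
move=> _ [z _ <-]; rewrite (le_trans (envelope_le N x z cf))// lerD2l.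
by rewrite ler_wpM2r ?mdist_ge0// ler_nat.
Qed.

(** The envelopes of f at x increase to every local lower bound c' of f: points
    at distance at least r from x are penalized by N r, which exceeds c' - c
    for N large. *)
Lemma envelope_lsc f c x c' : (forall y, c <= f y) ->
  (\forall y \near x, c' <= f y) -> exists N, c' <= envelope N f x.
Proof.
move=> cf /nbhs_ballP[r /= r0 xr].
have [c'c|cc'] := leP c' c; first by exists 0%N; exact/(le_trans c'c)/envelope_ge.
exists (Num.truncn ((c' - c) / r)).+1.
apply: lb_le_inf; first by eexists; exists x.
move=> _ [z _ <-]; have [xz|rz] := ltP (mdist x z) r.
  have /xr c'z : ball x r z by rewrite ballEmdist.
  by rewrite (le_trans c'z)// lerDl mulr_ge0// mdist_ge0.
rewrite -lerBlDl (@le_trans _ _ (c' - c))//; first by rewrite lerD2l lerN2.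
rewrite (@le_trans _ _ ((Num.truncn ((c' - c) / r)).+1%:R * r))//; last by rewrite ler_wpM2l.
by rewrite -ler_pdivrMr// ltW// truncnS_gt// divr_ge0// ?subr_ge0 ltW.
Qed.

(** The finite form of compactness behind the theorem of Dini. *)
Lemma increasing_cover (W : nat -> set X) : compact [set: X] ->
  (forall N, open (W N)) -> (forall N N', (N <= N')%N -> W N `<=` W N') ->
  (forall x, exists N, W N x) -> exists N, forall x, W N x.
Proof.
rewrite compact_cover => cX oW homoW covW.
have [||D _ DW] := cX nat setT W; first by move=> N _; exact: oW.
  by move=> x _; have [N] := covW x; exists N.
exists (\max_(N <- D) N)%N => x; have [N /= ND] := DW x I.
by apply: homoW; exact: leq_bigmax_seq.
Qed.

Lemma continuous_bounded f : compact [set: X] -> continuous f ->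
  exists B : R, forall x, `|f x| <= B.
Proof.
move=> cX cf; have [|||N NP] := @increasing_cover (fun N => [set x | `|f x| < N%:R]) cX.
- move=> N; rewrite (_ : [set _ | _] = (fun x => `|f x|) @^-1` [set z | z < N%:R])//.
  apply: open_comp; last exact: open_lt.
  by move=> x _; apply: continuous_comp (cf x) _; exact: norm_continuous.
- by move=> N N' NN x /= /lt_le_trans; apply; rewrite ler_nat.
- by move=> x; exists (Num.truncn `|f x|).+1; exact: truncnS_gt.
by exists N%:R => x; exact/ltW/NP.
Qed.

(** The envelopes of f increase to f pointwise, hence uniformly. *)
Lemma lipschitz_dense f (e : R) : compact [set: X] -> continuous f -> 0 < e ->
  exists N (g : X -> R), lipschitz N g /\ forall x, `|f x - g x| <= e.
Proof.
move=> cX cf e0; have [B fB] := continuous_bounded cX cf.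
have bf y : - B <= f y by have := fB y; rewrite ler_norml => /andP[].
have [|||N NP] := @increasing_cover (fun N => [set x | f x - envelope N f x < e]) cX.
- move=> N; rewrite (_ : [set _ | _] = (f \- envelope N f) @^-1` [set z | z < e])//.
  apply: open_comp; last exact: open_lt.
  by move=> x _; apply: cvgB (cf x) _; exact: (envelope_continuous bf).
- move=> N N' NN x /=; apply: le_lt_trans; rewrite lerD2l lerN2.
  exact: (envelope_homo x bf).
- move=> x; have [|N NP] := @envelope_lsc f (- B) x (f x - e / 2) bf.
    have e2 : 0 < e / 2 by rewrite divr_gt0.
    have /cvgrPdist_le/(_ _ e2) := cf x; apply: filterS => y.
    by rewrite ler_norml => /andP[]; lra.
  by exists N => /=; lra.
exists N, (envelope N f); split=> [|x]; first exact: envelope_lipschitz bf.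
have /= /ltW h := NP x; rewrite ger0_norm ?h// subr_ge0; exact: (envelope_le_fun N x bf).
Qed.

End lipschitz_envelope.

(** * Positive functionals and the Riesz outer measure *)

Record positive_functional {R : realType} {X : pmetricType R}
    (Lam : (X -> R) -> R) : Prop := {
  functionalD : forall f g : X -> R, continuous f -> continuous g ->
    Lam (f \+ g) = Lam f + Lam g ;
  functionalZ : forall (c : R) (f : X -> R), continuous f -> Lam (c \*o f) = c * Lam f ;
  functional_ge0 : forall f : X -> R, continuous f -> (forall x, 0 <= f x) -> 0 <= Lam f
}.

Section positive_functionals.
Context {R : realType} {X : pmetricType R}.
Variable Lam : (X -> R) -> R.
Hypothesis LamP : positive_functional Lam.
Implicit Types (f g : X -> R) (c : R).

Let LamD := functionalD LamP.
Let LamZ := functionalZ LamP.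

Lemma continuous_cst c : continuous (cst c : X -> R).
Proof. by move=> x; exact: cvg_cst. Qed.

Lemma continuous_addf f g : continuous f -> continuous g -> continuous (f \+ g).
Proof. by move=> cf cg x; apply: cvgD; [exact: cf|exact: cg]. Qed.

Lemma continuous_scalef c f : continuous f -> continuous (c \*o f).
Proof. by move=> cf x; apply: cvgMr; exact: cf. Qed.

Lemma continuous_subf f g : continuous f -> continuous g -> continuous (f \- g).
Proof. by move=> cf cg x; apply: cvgB; [exact: cf|exact: cg]. Qed.

Lemma continuous_sumf (F : nat -> X -> R) N : (forall i, continuous (F i)) ->
  continuous (fun x => \sum_(i < N) F i x).
Proof.
move=> cF; elim: N => [|N IH].
  by under eq_fun do rewrite big_ord0; exact: continuous_cst.
by under eq_fun do rewrite big_ord_recr; exact: continuous_addf.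
Qed.

Lemma functionalB f g : continuous f -> continuous g -> Lam (f \- g) = Lam f - Lam g.
Proof.
move=> cf cg; have -> : f \- g = f \+ (-1 \*o g) by apply/funext => x /=; rewrite mulN1r.
by rewrite LamD ?LamZ ?mulN1r//; exact: continuous_scalef.
Qed.

Lemma functional_le f g : continuous f -> continuous g -> (forall x, f x <= g x) ->
  Lam f <= Lam g.
Proof.
move=> cf cg fg; rewrite -subr_ge0 -functionalB//; apply: (functional_ge0 LamP).
  exact: continuous_subf.
by move=> x; rewrite subr_ge0.
Qed.

Lemma functional_cst c : Lam (cst c) = c * Lam (cst 1).
Proof.
rewrite -LamZ; last exact: continuous_cst.
by congr (Lam _); apply/funext => x /=; rewrite mulr1.
Qed.

Lemma functional_sum (F : nat -> X -> R) N : (forall i, continuous (F i)) ->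
  Lam (fun x => \sum_(i < N) F i x) = \sum_(i < N) Lam (F i).
Proof.
move=> cF; elim: N => [|N IH].
  under eq_fun do rewrite big_ord0.
  by rewrite big_ord0 (functional_cst 0) mul0r.
rewrite big_ord_recr/= -IH -LamD//; last exact: continuous_sumf.
by congr (Lam _); apply/funext => x; rewrite big_ord_recr.
Qed.

End positive_functionals.

Section riesz_outer_measure.
Context {R : realType} {X : pmetricType R}.
Variable Lam : (X -> R) -> R.
Hypothesis cX : compact [set: X].
Hypothesis LamP : positive_functional Lam.
Implicit Types (f g : X -> R) (U A : set X) (c e : R).

Let LamD := functionalD LamP.
Let LamZ := functionalZ LamP.
Let Lam_cst := functional_cst LamP.

Let le_Lam f g : continuous f -> continuous g -> (forall x, f x <= g x) ->
  Lam f <= Lam g := @functional_le _ _ _ LamP f g.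

Let Lam1_ge0 : 0 <= Lam (cst 1).
Proof. by apply: (functional_ge0 LamP) => //; exact: continuous_cst. Qed.

(** The continuous functions between 0 and the indicator of U. *)
Definition test U : set (X -> R) := [set f : X -> R | continuous f /\
  (forall x, 0 <= f x <= 1) /\ forall x, ~ U x -> f x = 0].

(** The mass that the representing measure must give to an open set U. *)
Definition inner U : R := sup (Lam @` test U).

Let test0 U : test U (cst 0).
Proof. by split; [exact: continuous_cst|split=> // x; rewrite lexx ler01]. Qed.

Lemma inner_ge U f : test U f -> Lam f <= inner U.
Proof.
move=> Uf; apply: sup_upper_bound; last by exists f.
split; first by exists (Lam f), f.
exists (Lam (cst 1)) => _ [g [cg [g1 _]] <-]; apply: le_Lam => //.
  exact: continuous_cst.
by move=> x; case/andP: (g1 x).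
Qed.

Lemma inner_le U c : (forall f, test U f -> Lam f <= c) -> inner U <= c.
Proof.
move=> Uc; apply: ge_sup; first by exists (Lam (cst 0)), (cst 0).
by move=> _ [f Uf <-]; exact: Uc.
Qed.

Lemma inner_ge0 U : 0 <= inner U.
Proof. by rewrite -(mul0r (Lam (cst 1))) -Lam_cst inner_ge. Qed.

Lemma inner_mono U U' : U `<=` U' -> inner U <= inner U'.
Proof.
move=> UU; apply: inner_le => f [cf [f1 fU]]; apply: inner_ge.
by split=> //; split=> // x U'x; apply: fU => /UU.
Qed.

Lemma inner0 : inner set0 = 0.
Proof.
apply/eqP; rewrite eq_le inner_ge0 andbT; apply: inner_le => f [_ [_ f0]].
have -> : f = cst 0 by apply/funext => x; exact: f0.
by rewrite Lam_cst mul0r.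
Qed.

Lemma innerT : inner setT = Lam (cst 1).
Proof.
apply/eqP; rewrite eq_le; apply/andP; split.
  apply: inner_le => f [cf [f1 _]]; apply: le_Lam => //; first exact: continuous_cst.
  by move=> x; case/andP: (f1 x).
apply: inner_ge; split; first exact: continuous_cst.
by split=> [x|x /(_ I)//]; rewrite /= ler01 lexx.
Qed.

Let ind_ge0 U y : (0 : R) <= \1_U y. Proof. by rewrite indicE. Qed.

(** The envelopes of the indicator of an open set are test functions that
    increase to the indicator. *)
Lemma test_envelope U N : test U (envelope N (\1_U)).
Proof.
split; first exact: (envelope_continuous (@ind_ge0 U)).
split=> x.
  apply/andP; split; first exact: (envelope_ge _ _ (@ind_ge0 U)).
  apply: (le_trans (envelope_le_fun N x (@ind_ge0 U))).
  by rewrite indicE; case: (_ \in _); rewrite ?lexx ?ler01.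
move=> Ux; apply/eqP; rewrite eq_le (envelope_ge _ _ (@ind_ge0 U)) andbT.
apply: (le_trans (envelope_le_fun N x (@ind_ge0 U))).
by rewrite indicE memNset.
Qed.

Lemma envelope_indic1 U x : open U -> U x -> exists N, 1 <= envelope N (\1_U : X -> R) x.
Proof.
move=> oU Ux; apply: (envelope_lsc (@ind_ge0 U)).
have := open_nbhs_nbhs (conj oU Ux); apply: filterS => y Uy.
by rewrite indicE mem_set.
Qed.

(** By compactness a test function of the union is at most d plus a finite sum
    of envelopes of the indicators of the U i, for any d > 0. *)
Lemma inner_bigcup (U : nat -> set X) c : (forall i, open (U i)) ->
  (forall N, \sum_(i < N) inner (U i) <= c) -> inner (\bigcup_i U i) <= c.
Proof.
move=> oU Uc; apply: inner_le => f [cf [f1 fU]].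
apply/ler_addgt0Pr => e e0.
pose g N (x : X) := \sum_(i < N) envelope N (\1_(U i) : X -> R) x.
have gi N i : continuous (envelope N (\1_(U i) : X -> R)).
  exact: (envelope_continuous (@ind_ge0 (U i))).
have gN N : continuous (g N).
  exact: (continuous_sumf (F := fun i => envelope N (\1_(U i) : X -> R))).
have gm N i x : 0 <= envelope N (\1_(U i) : X -> R) x.
  exact: (envelope_ge _ _ (@ind_ge0 (U i))).
set d := e / (Lam (cst 1) + 1).
have L10 : 0 < Lam (cst 1) + 1 by rewrite ltr_wpDl.
have d0 : 0 < d by rewrite divr_gt0.
have [|||N NP] := @increasing_cover _ _ (fun N => [set x | (f \- g N) x < d]) cX.
- move=> N; apply: (@open_comp _ _ (f \- g N) [set z | z < d]); last exact: open_lt.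
  by move=> x _; exact: (continuous_subf cf (gN N)).
- move=> N N' NN x /=; apply: le_lt_trans; rewrite lerD2l lerN2 /g.
  rewrite -[in leRHS](subnKC NN) big_split_ord/=.
  rewrite ler_wpDr ?sumr_ge0//; apply: ler_sum => i _.
  by rewrite subnKC// (envelope_homo x (@ind_ge0 (U i))).
- move=> x; have [[i _ Ux]|nU] := pselect ((\bigcup_i U i) x).
    have [N0 N1] := envelope_indic1 (oU i) Ux.
    pose N := maxn N0 i.+1; exists N => /=; have iN : (i < N)%N := leq_maxr _ _.
    rewrite /g (bigD1 (Ordinal iN))//= opprD addrA.
    have h1 : 1 <= envelope N (\1_(U i) : X -> R) x.
      by rewrite (le_trans N1)// (envelope_homo x (@ind_ge0 (U i))) ?leq_maxl.
    have h2 : 0 <= \sum_(j < N | j != Ordinal iN) envelope N (\1_(U j) : X -> R) x.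
      by rewrite sumr_ge0.
    by have /andP[_ h3] := f1 x; lra.
  by exists 0%N; rewrite /= /g big_ord0 fU// subr0.
have : Lam f <= Lam (g N \+ (d \*o cst 1)).
  apply: le_Lam => //.
    by apply: continuous_addf => //; exact/continuous_scalef/continuous_cst.
  by move=> x; have := NP x; rewrite /= mulr1; lra.
rewrite LamD//; last exact/continuous_scalef/continuous_cst.
rewrite LamZ; last exact: continuous_cst.
rewrite (functional_sum LamP (F := fun i => envelope N (\1_(U i) : X -> R)))//.
move=> /le_trans; apply.
rewrite lerD//.
  apply: le_trans (Uc N); apply: ler_sum => i _; exact/inner_ge/test_envelope.
by rewrite /d mulrAC ler_pdivrMr// ler_wpM2l ?(ltW e0)// lerDl.
Qed.

(** Half of the additivity of [inner], in the form that the measurability of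
    open sets requires.  Let f be a test function of V and U.  Its part above
    the height d is supported where f > d, and the remaining open set
    W = V and (f < d) contains V minus U; so this part and a test function of W
    add up to a test function of V. *)
Lemma inner_split U V c : open U -> open V ->
  (forall W, open W -> V `\` U `<=` W -> c <= inner W) ->
  inner (V `&` U) + c <= inner V.
Proof.
move=> oU oV Wc; rewrite -lerBrDr; apply: inner_le => f [cf [f1 fVU]].
rewrite lerBrDr; apply/ler_addgt0Pr => e e0.
have L10 : 0 < Lam (cst 1) + 1 by rewrite ltr_wpDl.
set d := e / (Lam (cst 1) + 1); have d0 : 0 < d by rewrite divr_gt0.
pose W := V `&` [set x | f x < d].
have oW : open W.
  apply: openI => //; apply: (@open_comp _ _ f [set z | z < d]); last exact: open_lt.
  by move=> x _; exact: cf.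
have VUW : V `\` U `<=` W.
  by move=> x [Vx Ux]; split=> //=; rewrite fVU// => -[].
pose fd (x : X) := Num.max (f x - d) 0.
have cfd : continuous fd.
  move=> x; apply: (@continuous_max _ _ (fun x => f x - d) (cst 0)); last exact: cvg_cst.
  exact: (continuous_subf cf (@continuous_cst R X d)).
have fdV : inner W <= inner V - Lam fd.
  apply: inner_le => g [cg [g1 gW]]; rewrite lerBrDl -LamD//; apply: inner_ge.
  split; first exact: continuous_addf.
  split=> x; rewrite /= /fd.
    have /andP[f0 f1x] := f1 x; have /andP[g0 g1x] := g1 x.
    have [fxd|df] := ltP (f x) d.
      by rewrite max_r ?subr_le0 ?(ltW fxd)// add0r.
    rewrite gW ?addr0; last by move=> [_ /=]; rewrite ltNge df.
    by rewrite max_l ?subr_ge0// df/=; lra.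
  move=> Vx; rewrite (fVU x); last by case.
  rewrite gW; last by case.
  by rewrite addr0 max_r// sub0r oppr_le0 ltW.
have : Lam f <= Lam (fd \+ (d \*o cst 1)).
  apply: le_Lam => //.
    by apply: continuous_addf => //; exact/continuous_scalef/continuous_cst.
  by move=> x; rewrite /fd/= mulr1 -lerBlDr le_max lexx.
rewrite LamD//; last exact/continuous_scalef/continuous_cst.
rewrite LamZ; last exact: continuous_cst.
have de : d * Lam (cst 1) <= e.
  by rewrite /d mulrAC ler_pdivrMr// ler_wpM2l ?(ltW e0)// lerDl.
by have := Wc _ oW VUW; lra.
Qed.

(** Outer regularity as a definition. *)
Definition outer A : R := inf (inner @` [set U | open U /\ A `<=` U]).

Let has_inf_outer A : has_inf (inner @` [set U | open U /\ A `<=` U]).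
Proof.
split; first by exists (inner setT), setT => //; split=> //; exact: openT.
by exists 0 => _ [U _ <-]; exact: inner_ge0.
Qed.

Lemma outer_le A U : open U -> A `<=` U -> outer A <= inner U.
Proof. by move=> oU AU; apply: inf_lbound; [case: (has_inf_outer A)|exists U]. Qed.

Lemma outer_ge A c : (forall U, open U -> A `<=` U -> c <= inner U) -> c <= outer A.
Proof.
move=> Uc; apply: lb_le_inf; first by case: (has_inf_outer A).
by move=> _ [U [oU AU] <-]; exact: Uc.
Qed.

Lemma outer_adherent A e : 0 < e ->
  exists U, [/\ open U, A `<=` U & inner U <= outer A + e].
Proof.
move=> /inf_adherent/(_ (has_inf_outer A))[_ [U [oU AU] <-] Ue].
by exists U; split=> //; exact: ltW.
Qed.

Lemma outer_ge0 A : 0 <= outer A.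
Proof. by apply: outer_ge => U _ _; exact: inner_ge0. Qed.

Lemma outer_mono A A' : A `<=` A' -> outer A <= outer A'.
Proof. by move=> AA; apply: outer_ge => U oU AU; apply: outer_le => // x /AA/AU. Qed.

Lemma outer_open U : open U -> outer U = inner U.
Proof.
move=> oU; apply/eqP; rewrite eq_le outer_le//=.
by apply: outer_ge => V _; exact: inner_mono.
Qed.

Definition riesz_outer A : \bar R := (outer A)%:E.

Lemma riesz_outer0 : riesz_outer set0 = 0%E.
Proof. by rewrite /riesz_outer outer_open ?inner0//; exact: open0. Qed.

Lemma riesz_outer_ge0 A : (0 <= riesz_outer A)%E.
Proof. by rewrite lee_fin outer_ge0. Qed.

Lemma le_riesz_outer : {homo riesz_outer : A B / A `<=` B >-> (A <= B)%E}.
Proof. by move=> A B AB; rewrite lee_fin outer_mono. Qed.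

Lemma riesz_outer_sigma_subadditive : sigma_subadditive riesz_outer.
Proof.
move=> F; apply/lee_addgt0Pr => e e0.
have eps n : 0 < e / (2 ^ n.+1)%:R by rewrite divr_gt0// ltr0n expn_gt0.
have /choice[U UP] n := outer_adherent (F n) (eps n).
rewrite (le_trans _ (epsilon_trick xpredT (fun n => riesz_outer_ge0 (F n)) (ltW e0)))//.
set T := (X in (_ <= X)%E).
have sumT N : (\sum_(i < N) (inner (U i))%:E <= T)%E.
  rewrite (le_trans _ (nneseries_lim_ge N _))//; last first.
    by move=> n _ _; rewrite adde_ge0 ?riesz_outer_ge0// lee_fin ltW.
  rewrite big_mkord; apply: lee_sum => i _; have [_ _ UiF] := UP i.
  by rewrite -EFinD lee_fin.
have : (riesz_outer (\bigcup_n F n) <= (inner (\bigcup_n U n))%:E)%E.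
  rewrite lee_fin outer_le//; first by apply: bigcup_open => i _; case: (UP i).
  by move=> x [i _ Fx]; exists i => //; case: (UP i) => _ + _; apply.
move=> /le_trans; apply; case: T sumT => [c|_|sumT]; last 2 first.
- by rewrite leey.
- by have := sumT 0%N; rewrite big_ord0.
move=> sumT; rewrite lee_fin inner_bigcup//; first by move=> i; case: (UP i).
by move=> N; have := sumT N; rewrite sumEFin lee_fin.
Qed.

HB.instance Definition _ := isOuterMeasure.Build R X riesz_outer
  riesz_outer0 riesz_outer_ge0 le_riesz_outer riesz_outer_sigma_subadditive.

(** Open sets are Caratheodory measurable by [inner_split], hence so are Borel
    sets. *)
Lemma borel_caratheodory :
  (@measurable _ (borel X)) `<=` riesz_outer.-cara.-measurable.
Proof.
apply: smallest_sub.
  split; [exact: measurable0| |].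
    by move=> A mA; rewrite setTD; exact: measurableC.
  by move=> F mF; exact: bigcupT_measurable.
move=> U oU; apply: le_caratheodory_measurable => A.
rewrite -EFinD lee_fin; apply: outer_ge => V oV AV.
apply: (le_trans _ (inner_split oU oV (c := outer (A `&` ~` U)) _)).
  by rewrite lerD2r outer_le//; [exact: openI|exact: setSI].
move=> W oW VW; apply: outer_le => // x [/AV Vx Ux]; exact: VW.
Qed.

Definition riesz_measure : set (borel X) -> \bar R := riesz_outer.

Let riesz_measure_sigma_additive : semi_sigma_additive riesz_measure.
Proof.
move=> F mF tF mUF; apply: (caratheodory_measure_sigma_additive (mu := riesz_outer)) => //.
  by move=> i; exact: (borel_caratheodory (mF i)).
exact: borel_caratheodory.
Qed.

HB.instance Definition _ := isMeasure.Build _ (borel X) R riesz_measure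
  riesz_outer0 riesz_outer_ge0 riesz_measure_sigma_additive.

HB.instance Definition _ := Measure_isFinite.Build _ (borel X) R riesz_measure
  (fun A _ => erefl : riesz_outer A \is a fin_num).

Lemma riesz_borel_measure :
  exists m : fmeas X, forall U, open U -> m U = (inner U)%:E.
Proof. by exists riesz_measure => U oU; rewrite -outer_open. Qed.

End riesz_outer_measure.

(** * Integration of continuous functions *)

Section pairing_continuous.
Context {R : realType} {X : pmetricType R}.
Hypothesis cX : compact [set: X].
Implicit Types (f g : X -> R) (m : fmeas X) (c : R).

Lemma continuous_borel_measurable f : continuous f ->
  measurable_fun [set: borel X] (f : borel X -> R).
Proof.
move=> /continuousP cf; apply: (measurability _ (RGenOpens.measurableE R)).
move=> _ [_ [a [b ->] <-]]; rewrite setTI; apply: sub_sigma_algebra.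
exact/cf/interval_open.
Qed.

Lemma continuous_integrable m f : continuous f ->
  m.-integrable [set: borel X] (EFin \o (f : borel X -> R)).
Proof.
move=> cf; have [B fB] := continuous_bounded cX cf.
apply: measurable_bounded_integrable => //.
- by rewrite -ge0_fin_numE ?fin_num_measure.
- exact: continuous_borel_measurable.
- exists B; split; first exact: num_real.
  by move=> M BM x _ /=; rewrite (le_trans (fB x))// ltW.
Qed.

Lemma pairing_functional m : positive_functional (fun f : X -> R => pairing f m).
Proof.
split=> [f g cf cg|c f cf|f cf f0].
- by rewrite /pairing RintegralD//; exact: continuous_integrable.
- by rewrite /pairing RintegralZl//; exact: continuous_integrable.
- by apply: Rintegral_ge0 => x _; exact: f0.
Qed.

Lemma pairing1 m : pairing (cst 1) m = fine (m setT).
Proof. by rewrite /pairing Rintegral_cst// mul1r. Qed.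

Lemma pairing1_gt0 m : posmeas m -> 0 < pairing (cst 1) m.
Proof.
move=> m0; rewrite pairing1 fine_gt0// lt0e m0 measure_ge0/=.
by rewrite -ge0_fin_numE ?fin_num_measure.
Qed.

Lemma pairing_fineK m f : continuous f ->
  (pairing f m)%:E = (\int[m]_(x in [set: borel X]) (f x)%:E)%E.
Proof.
move=> cf; rewrite /pairing/Rintegral fineK//.
by apply: integrable_fin_num => //; exact: (continuous_integrable m cf).
Qed.

(** The mass of an open set is the limit of the integrals of the envelopes of
    its indicator, by monotone convergence, and open sets are a pi-system that
    generates the Borel sets. *)
Lemma pairing_eqmeas m1 m2 :
  (forall f, continuous f -> pairing f m1 = pairing f m2) -> eqmeas m1 m2.
Proof.
move=> m12; have ind0 (U : set X) y : (0 : R) <= \1_U y by rewrite indicE.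
have mU (m : fmeas X) U : open U ->
    (fun N => (pairing (envelope N (\1_U)) m)%:E) @ \oo --> m U.
  move=> oU; have mUb : measurable (U : set (borel X)) by exact: sub_sigma_algebra.
  have ce N : continuous (envelope N (\1_U : X -> R)) by exact: envelope_continuous (ind0 U).
  under eq_fun do rewrite pairing_fineK//.
  rewrite -[U in m U]setIT -integral_indic//.
  pose g N (x : borel X) : \bar R := (envelope N (\1_U : X -> R) x)%:E.
  have gcvg x : g ^~ x @ \oo --> (\1_U x : R)%:E.
    have [Ux|nUx] := pselect (U x).
      have [N0 N1] := envelope_indic1 oU Ux.
      apply: cvg_near_cst; exists N0 => // N /= NN.
      rewrite /g indicE mem_set//=; apply/eqP; rewrite eqe eq_le.
      rewrite (le_trans N1 (envelope_homo x (ind0 U) NN)) andbT.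
      rewrite (le_trans (envelope_le_fun N x (ind0 U)))// indicE.
      by case: (_ \in _); rewrite ?lexx ?ler01.
    apply: cvg_near_cst; apply: nearW => N.
    rewrite /g indicE memNset//=; apply/eqP.
    rewrite eqe eq_le (envelope_ge _ _ (ind0 U)) andbT.
    by rewrite (le_trans (envelope_le_fun N x (ind0 U)))// indicE memNset.
  have -> : (\int[m]_(x in setT) (\1_U x)%:E = \int[m]_(x in [set: borel X]) limn (g ^~ x))%E.
    by apply: eq_integral => x _; apply/esym/cvg_lim => //; exact: gcvg.
  apply: cvg_monotone_convergence => //.
  - by move=> N; apply/measurable_EFinP; exact: continuous_borel_measurable.
  - by move=> N x _; rewrite lee_fin; exact: envelope_ge (ind0 U).
  - by move=> x _ N N' NN; rewrite lee_fin; exact: envelope_homo (ind0 U) NN.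
move=> A mA.
apply: (@measure_unique _ R (borel X) (@open X) (fun=> setT) erefl _ _ _ m1 m2) => //.
- exact: openI.
- by move=> _; exact: openT.
- by rewrite bigcup_const//; exists 0%N.
- move=> U oU; have h1 := mU m1 U oU; have h2 := mU m2 U oU.
  have e : (fun N => (pairing (envelope N (\1_U : X -> R)) m1)%:E) =
      (fun N => (pairing (envelope N (\1_U : X -> R)) m2)%:E).
    by apply/funext => N; rewrite m12//; exact: envelope_continuous (ind0 U).
  by rewrite e in h1; exact: (cvg_unique _ h1 h2).
- by move=> _; rewrite -ge0_fin_numE ?fin_num_measure.
Qed.

(** For nonnegative functions this is the scaling of extended integrals, and a
    continuous function becomes nonnegative when a constant is added. *)
Lemma eq_pairing m1 m2 c f : 0 <= c -> continuous f -> scalar_multiple c m1 m2 ->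
  pairing f m1 = c * pairing f m2.
Proof.
move=> c0 cf m12; pose m3 : fmeas X := mscale (NngNum c0) m2.
have pos g : continuous g -> (forall x, 0 <= g x) -> pairing g m1 = c * pairing g m2.
  move=> cg g0; apply: EFin_inj; rewrite EFinM !pairing_fineK//.
  rewrite (eq_measure_integral m3); last by move=> A mA _; exact: m12.
  rewrite /m3 ge0_integral_mscale//.
    by apply/measurable_EFinP; exact: continuous_borel_measurable cg.
  by move=> x _; rewrite lee_fin.
have [B fB] := continuous_bounded cX cf.
have cB : continuous (f \+ cst B) by apply: continuous_addf => //; exact: continuous_cst.
have : pairing (f \+ cst B) m1 = c * pairing (f \+ cst B) m2.
  apply: pos => // x; have := fB x; rewrite ler_norml /= => /andP[]; lra.
rewrite !(functionalD (pairing_functional _))//; [|exact: continuous_cst..].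
rewrite mulrDr (pos (cst B)); [by move=> /addIr|exact: continuous_cst|move=> x /=].
exact: le_trans (fB x).
Qed.

Lemma pairing_scalar_multiple m1 m2 c : 0 <= c ->
  (forall f, continuous f -> pairing f m1 = c * pairing f m2) ->
  scalar_multiple c m1 m2.
Proof.
move=> c0 m12; pose m3 : fmeas X := mscale (NngNum c0) m2.
have : eqmeas m1 m3.
  apply: pairing_eqmeas => f cf; rewrite m12//; apply/esym.
  exact: (@eq_pairing m3 m2).
by move=> h A mA; rewrite h.
Qed.

End pairing_continuous.

(** * The Riesz representation theorem *)

Section riesz_representation.
Context {R : realType} {X : pmetricType R}.
Hypothesis cX : compact [set: X].

Definition clamp (u : R) : R := Num.max 0 (Num.min 1 u).

Lemma clamp_itv u : 0 <= clamp u <= 1.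
Proof. by rewrite /clamp le_max lexx/= ge_max ler01 ge_min lexx. Qed.

Lemma clamp0 u : u <= 0 -> clamp u = 0.
Proof.
by move=> u0; rewrite /clamp min_r ?max_l//; apply: (le_trans u0).
Qed.

Lemma clamp1 u : 1 <= u -> clamp u = 1.
Proof. by move=> u1; rewrite /clamp min_l// max_r. Qed.

Lemma continuous_clamp (f : X -> R) : continuous f -> continuous (fun x => clamp (f x)).
Proof.
move=> cf x; apply: (@continuous_max _ _ (cst 0) (fun x => Num.min 1 (f x))).
  exact: cvg_cst.
by apply: (@continuous_min _ _ (cst 1) f); [exact: cvg_cst|exact: cf].
Qed.

(** Decomposition of u into horizontal slices of height 1. *)
Lemma sum_clamp u N : 0 <= u -> \sum_(j < N) clamp (u - j%:R) = Num.min u N%:R.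
Proof.
move=> u0; elim: N => [|N IH]; first by rewrite big_ord0 min_r.
rewrite big_ord_recr/= IH; have [uN|Nu] := leP u N%:R.
  rewrite clamp0 ?subr_le0// addr0 min_l//.
  by rewrite (le_trans uN)// ler_nat.
have [uN1|/ltW N1u] := leP u N.+1%:R; last first.
  by rewrite clamp1 -?natr1 // lerBrDl natr1.
rewrite /clamp (@min_r _ _ 1) ?max_r ?subr_ge0 ?(ltW Nu)// ?lerBlDl ?natr1//.
by rewrite addrC subrK.
Qed.

(** Let s j be the slice of N f between the heights j and j + 1, and U j the
    open set where N f > j.  Then s j is a test function of U j, and it is 1 on
    U (j + 1).  Summation over j gives N Lam f <= m (U 0) + N times the
    integral of f, and N is arbitrary. *)
Lemma riesz_le (Lam : (X -> R) -> R) (m : fmeas X) (LamP : positive_functional Lam) :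
  (forall U, open U -> m U = (inner Lam U)%:E) ->
  forall f : X -> R, continuous f -> (forall x, 0 <= f x <= 1) ->
  Lam f <= pairing f m.
Proof.
move=> mU f cf f01; have PP := pairing_functional cX m.
have L1 : Lam (cst 1) = pairing (cst 1) m.
  by rewrite pairing1 mU ?innerT//; exact: openT.
have L10 : 0 <= Lam (cst 1) by apply: (functional_ge0 LamP) => //; exact: continuous_cst.
suff H N : (0 < N)%N -> N%:R * Lam f <= Lam (cst 1) + N%:R * pairing f m.
  apply/ler_addgt0Pr => e e0.
  set N := (Num.truncn (Lam (cst 1) / e)).+1.
  rewrite -(ler_pM2l (ltr0Sn _ _ : 0 < N%:R)) (le_trans (H N isT))// mulrDr addrC lerD2l.
  by rewrite -ler_pdivrMr// ltW// truncnS_gt.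
move=> N0; pose s j (x : X) := clamp (N%:R * f x - j%:R).
have cs j : continuous (s j).
  apply: continuous_clamp; apply: continuous_subf; first exact: continuous_scalef.
  exact: continuous_cst.
have sumE : N%:R \*o f = fun x => \sum_(j < N) s j x.
  apply/funext => x; have /andP[f0 f1] := f01 x.
  by rewrite sum_clamp ?mulr_ge0//= min_l// ler_piMr.
pose U j := [set x : X | j%:R < N%:R * f x].
have oU j : open (U j).
  apply: (@open_comp _ _ (N%:R \*o f) [set z | j%:R < z]); last exact: open_gt.
  by move=> x _; exact: continuous_scalef.
have LU j : Lam (s j) <= inner Lam (U j).
  apply: inner_ge => //; split=> //; split=> x; first exact: clamp_itv.
  by move=> /negP; rewrite -leNgt => Uj; rewrite /s clamp0// subr_le0.
have Us j : inner Lam (U j.+1) <= pairing (s j) m.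
  rewrite -lee_fin pairing_fineK// -mU// -[U _ in leLHS]setIT.
  have mUb : measurable (U j.+1 : set (borel X)) by exact: sub_sigma_algebra.
  rewrite -integral_indic//; apply: ge0_le_integral => //.
  - by apply/measurable_EFinP; exact: measurable_indic.
  - by apply/measurable_EFinP; exact: continuous_borel_measurable (cs j).
  move=> x _; rewrite lee_fin indicE; have [/set_mem Ux|_] := boolP (x \in _).
    by rewrite /s clamp1// lerBrDl natr1 ltW.
  by have /andP[] := clamp_itv (N%:R * f x - j%:R).
rewrite -(functionalZ LamP)// -(functionalZ PP)// sumE.
rewrite (functional_sum LamP)// (functional_sum PP)//.
case: N N0 @s @U cs sumE oU LU Us => // N _ s U cs sumE oU LU Us.
rewrite big_ord_recl [X in _ <= _ + X]big_ord_recr/= lerD//.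
  rewrite (le_trans (LU 0%N))// -(innerT LamP); exact: inner_mono.
rewrite (@le_trans _ _ (\sum_(i < N) pairing (s i) m))//.
  by apply: ler_sum => i _; exact: le_trans (LU _) (Us _).
rewrite lerDl; apply: (functional_ge0 PP) => // x.
by have /andP[] := clamp_itv (N.+1%:R * f x - N%:R).
Qed.

(** The inequality of [riesz_le] extends to all continuous functions by affine
    rescaling, and becomes an equality when it is applied to f and to - f. *)
Theorem riesz (Lam : (X -> R) -> R) : positive_functional Lam ->
  exists m : fmeas X, forall f : X -> R, continuous f -> pairing f m = Lam f.
Proof.
move=> LamP; have [m mU] := riesz_borel_measure cX LamP; exists m.
have PP := pairing_functional cX m.
have L1 : Lam (cst 1) = pairing (cst 1) m.
  by rewrite pairing1 mU ?innerT//; exact: openT.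
have le f : continuous f -> Lam f <= pairing f m.
  move=> cf; have [B fB] := continuous_bounded cX cf.
  have B0 : 0 <= B by rewrite (le_trans (normr_ge0 _) (fB point)).
  have B1 : 0 < 2 * B + 1 by lra.
  have cc c := @continuous_cst R X c.
  have cfB := continuous_addf cf (cc B).
  pose g := (2 * B + 1)^-1 \*o (f \+ cst B).
  have cg : continuous g by exact: continuous_scalef.
  have := riesz_le LamP mU cg; rewrite (functionalZ LamP)// (functionalZ PP)//.
  rewrite (functionalD LamP)// (functionalD PP)// (functional_cst LamP) (functional_cst PP) L1.
  rewrite ler_pM2l ?invr_gt0// lerD2r; apply => x.
  have := fB x; rewrite /g/= ler_norml => /andP[h1 h2].
  rewrite mulrC ler_pdivrMr// mul1r divr_ge0//=; lra.
move=> f cf; apply/eqP; rewrite eq_le le// andbT.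
have := le _ (continuous_scalef (c := -1) cf).
by rewrite (functionalZ LamP)// (functionalZ PP)// !mulN1r lerN2.
Qed.

End riesz_representation.

(** * The disjoint union of the spaces *)

Section total_space.
Context {R : realType} {X : int -> pmetricType R}.
Variables (T : forall n : int, X n -> X (n + 1)) (phi : forall n : int, X n -> R).
Variables (delta beta : R).

Definition total := {n : int & X n}.
HB.instance Definition _ := Choice.on total.

Definition pt_of n (x : X n) : total := existT (fun n => X n : Type) n x.
Definition base (e : total) : int := tag e.
Definition totalT (e : total) : total := pt_of (T (tagged e)).
Definition total_phi (e : total) : R := phi (tagged e).

(** Points of different spaces are never close. *)
Definition close (e e' : total) : Prop :=
  exists2 x : X (tag e), e' = pt_of x & mdist (tagged e) x <= delta.

(** The value 0 between different spaces is a default that is never compared,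
    since [close] holds only within one space. *)
Definition total_dist (e e' : total) : R :=
  if tag e' =P tag e is ReflectT p then mdist (tagged e) (castpt p (tagged e')) else 0.

Definition holder_dist (e e' : total) : R := total_dist e e' `^ beta.

Lemma pt_of_inj n : injective (@pt_of n).
Proof. by move=> x y; exact: eq_from_Tagged. Qed.

Lemma holder_distE n (x x' : X n) :
  holder_dist (pt_of x) (pt_of x') = mdist x x' `^ beta.
Proof.
rewrite /holder_dist /total_dist; case: eqP => //= p.
by rewrite (eq_irrelevance p erefl).
Qed.

Lemma pt_of_cast i j (p : i = j) (x : X i) : pt_of (castpt p x) = pt_of x.
Proof. by case: j / p. Qed.

Lemma iter_totalT n k (x : X n) : iter k totalT (pt_of x) = pt_of (iterT T n k x).
Proof.
elim: k => [|k IH] /=; first by rewrite pt_of_cast.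
by rewrite IH pt_of_cast.
Qed.

Lemma base_succ (e : total) : exists n (x : X (n + 1)), e = pt_of x.
Proof.
case: e => n x; exists (n - 1).
by exists (castpt (esym (subrK 1 n)) x); rewrite pt_of_cast.
Qed.

Lemma totalT_preimage n (x : X (n + 1)) :
  totalT @^-1` [set pt_of x] = @pt_of n @` (@T n @^-1` [set x]).
Proof.
apply/seteqP; split=> [[m y]|_ [y Ty <-]] /=; last by rewrite /totalT/= Ty.
move=> e; have mn : m = n by apply: (@addIr _ 1); exact: (congr1 tag e).
by case: n / mn x e => x /pt_of_inj Ty; exists y.
Qed.

Definition slice n (F : total -> R) : X n -> R := fun x => F (pt_of x).
Arguments slice n F x : clear implicits.

(** Extension by 0 to the other spaces. *)
Definition ext n (f : X n -> R) : total -> R :=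
  fun e => if tag e =P n is ReflectT p then f (castpt p (tagged e)) else 0.

Lemma ext_slice n (f : X n -> R) : slice n (ext f) = f.
Proof.
apply/funext => x; rewrite /slice /ext; case: eqP => //= p.
by rewrite (eq_irrelevance p erefl).
Qed.

Lemma castfun_slice i j (p : i = j) F : castfun p (slice i F) = slice j F.
Proof. by case: j / p. Qed.

Lemma transfer_slice n F :
  transfer T phi n (slice n F) = slice (n + 1) (ruelle totalT total_phi F).
Proof.
apply/funext => x; rewrite /slice /ruelle totalT_preimage fsbig_image//.
by move=> y z _ _; exact: pt_of_inj.
Qed.

(** The iterates of L_n, which carry casts between the indices n + k, are the
    restrictions of plain iterates of one operator. *)
Lemma transfer_iter_slice n k F : transfer_iter T phi n k (slice n F) =
  slice (n + k%:Z) (iter k (ruelle totalT total_phi) F).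
Proof.
elim: k => [|k IH] /=; first exact: castfun_slice.
by rewrite IH transfer_slice castfun_slice.
Qed.

Lemma transfer_from_slice n k F : transfer_from T phi n k (slice (n - k%:Z) F) =
  slice n (iter k (ruelle totalT total_phi) F).
Proof. by rewrite /transfer_from transfer_iter_slice castfun_slice. Qed.

End total_space.

Arguments slice {R X} n F x.

(** In [exp_sep], two distinct preimages of one point are more than delta apart,
    while z is within rho d(S x, S z) of each of them; hence
    delta < 2 d(S x, S z). *)
Lemma total_expanding {R : realType} {X : int -> pmetricType R}
    (T : forall n : int, X n -> X (n + 1)) (phi : forall n : int, X n -> R)
    (delta beta : R) (tau : nat) :
  (forall n, continuous (phi n)) ->
  condA1 T -> condA2 T delta -> condA3 T delta tau -> condA4 phi delta beta ->
  exists (D : nat) (V H r a b : R),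
    expanding (totalT T) (total_phi phi) (@base R X) (close delta)
      (holder_dist beta) D tau V H r a b.
Proof.
move=> phi_cont [cX [_ [D fibD]]] [delta0 [[rho [/andP[rho0 rho1] Trho]] Tball]] A3.
move=> [/andP[beta0 beta1] [[H [H0 phiH]] [V [V0 phiV]]]].
have le_beta (x y : R) : 0 <= x -> x <= y -> x `^ beta <= y `^ beta.
  move=> x0 xy; apply: ge0_ler_powR; rewrite ?nnegrE//; first exact: ltW.
  exact: le_trans xy.
exists D, V, H, (rho `^ beta), (delta `^ beta), ((delta / 2) `^ beta); split.
- move=> e; have [n [x ->]] := base_succ e; have [k [kD xk]] := fibD n x.
  exists k; split=> //; rewrite totalT_preimage; apply: card_eq_trans xk.
  by apply: inj_card_eq => y z _ _; exact: pt_of_inj.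
- move=> [n x]; apply: le_trans (phiV n); rewrite /supnorm/total_phi/=.
  have [B phiB] := continuous_bounded (cX n) (phi_cont n).
  apply: sup_upper_bound; last by exists x.
  by split; [exists `|phi n x|, x|exists B => _ [y _ <-]].
- move=> [n x] _ [y -> xy]; rewrite (holder_distE beta x y); exact: phiH.
- by move=> n; exists (pt_of (point : X n)).
- by [].
- by move=> e _ [y -> _].
- by move=> x y; exact: powR_ge0.
- move=> [n x] _ [y -> xy]; rewrite (holder_distE beta x y).
  by rewrite le_beta ?mdist_ge0.
- move=> [n x] _ [y -> xy] /=; have [z xz <-] := Tball _ _ _ xy.
  by exists (pt_of z) => //; exists z.
- move=> [n x] _ [y -> xy]; rewrite (holder_distE beta x y) /totalT/=.
  rewrite (holder_distE beta (T n x) (T n y)) -powRM ?mdist_ge0 ?(ltW rho0)//.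
  by rewrite le_beta ?mdist_ge0// Trho.
- move=> [n x] [n' y] _ xy Sxy [z -> xz] [z' zz' yz'].
  have nn' : n = n' := congr1 tag zz'.
  case: n' / nn' y xy Sxy z' zz' yz' => y xy Sxy z' /pt_of_inj <- yz.
  have Txy : T n x = T n y by exact: pt_of_inj Sxy.
  rewrite /totalT/= (holder_distE beta (T n x) (T n z)) le_beta ?divr_ge0 ?(ltW delta0)//.
  have [dxy|dxy] := leP (mdist x y) delta.
    have := Trho _ _ _ dxy; rewrite Txy mdistxx mulr0 => d0.
    suff e : x = y by rewrite e eqxx in xy.
    by apply: mdist_positivity; apply/eqP; rewrite eq_le d0 mdist_ge0.
  have := metric_triangle x z y; rewrite (metric_sym z y).
  have := Trho _ _ _ xz; have := Trho _ _ _ yz; rewrite -Txy => h1 h2 h3.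
  have : rho * mdist (T n x) (T n z) <= mdist (T n x) (T n z).
    by rewrite ler_piMl ?mdist_ge0// ltW.
  rewrite ler_pdivrMr//; lra.
- move=> [n x] [n' w] /= /esym nn'; case: n' / nn' w => w.
  have : (iterT T n tau @` cball x delta) w by rewrite A3.
  move=> [y xy <-]; exists (pt_of y); first by exists y.
  exact: iter_totalT.
- exact: ltW.
- rewrite powR_gt0//=; have := @gt0_ltr_powR R beta beta0 rho 1.
  by rewrite powR1 !nnegrE ler01 (ltW rho0); apply.
- exact: powR_ge0.
- by rewrite powR_gt0// divr_gt0.
Qed.

(** * Continuity of functions of the cone and of their images *)

(** The Riesz theorem provides the measure that defines the dual operator. *)
Lemma dualP {R : realType} {X Y : pmetricType R} (L : (X -> R) -> (Y -> R))
    (s : fmeas Y) : compact [set: X] ->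
  positive_functional (fun f : X -> R => pairing (L f) s) ->
  forall f : X -> R, continuous f -> pairing f (dual L s) = pairing (L f) s.
Proof.
move=> cX /(riesz cX)[m mL] f cf.
exact: (@xgetPex {classic fmeas X} mzero (fun m' : {classic fmeas X} =>
  forall f : X -> R, continuous f -> pairing f (m' : fmeas X) = pairing (L f) s)
  (ex_intro _ (m : {classic fmeas X}) mL) f cf).
Qed.

Lemma expR_powR_small {R : realType} (Q beta e : R) : 0 < Q -> 0 < beta -> 0 < e ->
  exists2 d : R, 0 < d & forall u, 0 <= u <= d -> expR (Q * u `^ beta) - 1 <= e.
Proof.
move=> Q0 b0 e0; have /cvgrPdist_le/(_ e e0) := @continuous_expR R 0.
move=> /nbhs_ballP[d1 /= d10 d1P].
pose d := (d1 / 2 / Q) `^ beta^-1.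
exists d; first by rewrite powR_gt0// !divr_gt0.
move=> u /andP[u0 ud].
have ub : u `^ beta <= d1 / 2 / Q.
  have -> : d1 / 2 / Q = d `^ beta.
    by rewrite /d -powRrM mulVf ?gt_eqF// powRr1// !divr_ge0// ltW.
  by apply: ge0_ler_powR; rewrite ?nnegrE ?powR_ge0// ltW.
have /d1P : ball (0 : R) d1 (Q * u `^ beta).
  rewrite /ball/= sub0r normrN ger0_norm ?mulr_ge0 ?powR_ge0 ?(ltW Q0)//.
  rewrite mulrC (le_lt_trans (ler_wpM2r (ltW Q0) ub))// divfK ?gt_eqF//.
  by rewrite ltr_pdivrMr// ltr_pMr// ltr1n.
by rewrite /= expR0 ler_norml => /andP[]; lra.
Qed.

Section conformal_measures.
Context {R : realType} {X : int -> pmetricType R}.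
Variables (T : forall n : int, X n -> X (n + 1)) (phi : forall n : int, X n -> R).
Variables (delta beta : R) (D tau : nat) (V H r a b Q : R).
Hypothesis cX : forall n, compact [set: X n].
Hypothesis delta0 : 0 < delta.
Hypothesis beta01 : 0 < beta < 1.
Hypothesis sys : expanding (totalT T) (total_phi phi) (@base R X) (close delta)
  (holder_dist beta) D tau V H r a b.
Hypothesis QQ : Qmin D H r b <= Q.
Local Notation E := (@total R X).
Implicit Types (F G : E -> R) (n : int) (k : nat).

Let Q0 : 0 < Q := lt_le_trans (Qmin_gt0 sys) QQ.
Let card := exp_card sys.
Let beta0 : 0 < beta. Proof. by case/andP: beta01. Qed.
Local Notation L := (ruelle (totalT T) (total_phi phi)).
Local Notation lcone := (lcone (@base R X) (close delta) (holder_dist beta) Q).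
Local Notation mean := (mean (totalT T) (total_phi phi) (@base R X)).
Local Notation meanable := (meanable (totalT T) (total_phi phi) (@base R X)).

Lemma extE n (f : X n -> R) x : ext f (pt_of x) = f x.
Proof. by rewrite -[RHS](congr1 (@^~ x) (ext_slice f)). Qed.

(** The cone inequality in both directions bounds |F y - F x| by
    (exp (Q d(x, y)^beta) - 1) F x. *)
Lemma lcone_continuous n F : lcone n F -> continuous (slice n F).
Proof.
move=> [F0 FQ] x; apply/cvgrPdist_le => e e0.
have Fx0 : 0 <= F (pt_of x) := F0 (pt_of x) erefl.
have F10 : 0 < F (pt_of x) + 1 by rewrite ltr_wpDl.
have [d d0 dP] := expR_powR_small Q0 beta0 (divr_gt0 e0 F10).
near=> y.
have [xyd xydelta] : mdist x y <= d /\ mdist x y <= delta.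
  split; near: y.
    by have := nbhsx_ballx x _ d0; rewrite ballEmdist; apply: filterS => y /ltW.
  by have := nbhsx_ballx x _ delta0; rewrite ballEmdist; apply: filterS => y /ltW.
have := FQ (pt_of x) (pt_of y) erefl (ex_intro2 _ _ y erefl xydelta).
have yx : mdist y x <= delta by rewrite metric_sym.
have := FQ (pt_of y) (pt_of x) erefl (ex_intro2 _ _ x erefl yx).
rewrite !(holder_distE beta) (metric_sym y x).
have := dP (mdist x y); rewrite mdist_ge0 xyd => /(_ isT).
set E := expR _ => Ee h1 h2; rewrite /slice.
have E1 : 0 <= E - 1.
  by rewrite subr_ge0 -expR0 ler_expR mulr_ge0 ?(ltW Q0)// powR_ge0.
have h3 : (E - 1) * F (pt_of x) <= e.
  rewrite (le_trans (ler_wpM2r Fx0 Ee))// mulrAC ler_pdivrMr//.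
  by rewrite ler_wpM2l ?(ltW e0)// lerDl.
have [xy|/ltW yx'] := leP (F (pt_of x)) (F (pt_of y)).
  by rewrite ler0_norm ?subr_le0//; lra.
rewrite ger0_norm ?subr_ge0//.
have := ler_wpM2l E1 yx'; lra.
Unshelve. all: by end_near. Qed.

Lemma lcone_of_cone n (f : X n -> R) : cone delta beta Q n f ->
  lcone n (ext f) /\ 0 < mean n (ext f).
Proof.
move=> [_ [f0 [[x fx] fQ]]]; have fQ' : lcone n (ext f).
  split=> [[m y] /= mn|[m y] z /= mn [y' -> yy']].
    by case: n / mn f f0 {fx fQ x} => f f0; rewrite extE.
  case: n / mn f f0 {fx x} fQ => f f0 fQ.
  by rewrite (holder_distE beta y y') !extE; exact: fQ.
split=> //; apply: (mean_gt0 sys QQ fQ' (z := pt_of x)) => //.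
by rewrite extE lt0r fx f0.
Qed.

Lemma cone_of_lcone n F : lcone n F -> (exists x : X n, F (pt_of x) != 0) ->
  cone delta beta Q n (slice n F).
Proof.
move=> FQ Fx; split; first exact: lcone_continuous.
split=> [x|]; first exact: FQ.1.
split=> // x x' xx'; rewrite -(holder_distE beta x x'); apply: FQ.2 => //.
by exists x'.
Qed.

(** With c large, 1 + v <= exp v gives the cone inequality, since
    N d <= N delta^(1 - beta) d^beta for d <= delta. *)
Lemma lipschitz_lcone n N (g : X n -> R) : lipschitz N g ->
  exists c, lcone n (ext g \+ cst c).
Proof.
move=> gN; have [B gB] := continuous_bounded (@cX n) (lipschitz_continuous gN).
pose c0 := N%:R * delta `^ (1 - beta) / Q.
have c00 : 0 <= c0 by rewrite divr_ge0 ?(ltW Q0)// mulr_ge0 ?powR_ge0.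
have gB' y : 0 <= g y + B by have := gB y; rewrite ler_norml => /andP[]; lra.
exists (B + c0); split=> [[m y] /= mn|[m y] z /= mn [y' -> yy']].
  by case: n / mn g gN gB gB' => g gN gB gB'; rewrite extE; have := gB' y; lra.
case: n / mn g gN gB gB' => g gN gB gB'.
rewrite (holder_distE beta y y') !extE.
set u := mdist y y' `^ beta; have u0 : 0 <= u := powR_ge0 _ _.
have dist_u : N%:R * mdist y y' <= Q * u * c0.
  rewrite /c0 mulrC [leRHS](_ : _ = u * delta `^ (1 - beta) * N%:R); last first.
    by field; exact: lt0r_neq0.
  rewrite ler_wpM2r// -{1}[mdist y y']powRr1 ?mdist_ge0//.
  rewrite -[1 in leLHS](subrKC beta) powRD; last first.
    by rewrite subrKC oner_eq0.
  rewrite ler_wpM2l//; apply: ge0_ler_powR; rewrite ?nnegrE ?mdist_ge0 ?(ltW delta0)//.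
  by rewrite subr_ge0 ltW//; case/andP: beta01.
have y'0 := gB' y'.
rewrite (@le_trans _ _ ((1 + Q * u) * (g y' + (B + c0))))//; last first.
  by rewrite ler_wpM2r ?expR_ge1Dx//; lra.
have := gN y y'; have : 0 <= Q * u * (g y' + B) by rewrite !mulr_ge0// ltW.
rewrite mulrDl mul1r [Q * u * (_ + (_ + _))]mulrDr [Q * u * (B + _)]mulrDr mulrDr.
lra.
Qed.

Lemma lcone_dense n (f : X n -> R) (e : R) : continuous f -> 0 < e ->
  exists G c, lcone n G /\ forall x : X n, `|f x - (G (pt_of x) - c)| <= e.
Proof.
move=> cf e0; have [N [g [gN fg]]] := lipschitz_dense (@cX n) cf e0.
have [c gc] := lipschitz_lcone gN; exists (ext g \+ cst c), c; split=> // x.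
by rewrite /= extE addrK.
Qed.

(** The cone and the constants span a uniformly dense set of functions. *)
Lemma lcone_dense_base n F (e : R) : continuous (slice n F) -> 0 < e ->
  exists G c, lcone n G /\ forall x, base x = n -> `|F x - (G \- cst c) x| <= e.
Proof.
move=> cF e0; have [G [c [GQ Gc]]] := lcone_dense cF e0; exists G, c; split=> //.
by move=> [m x] /= mn; case: n / mn cF GQ Gc => cF GQ Gc; exact: Gc.
Qed.

Lemma meanable_sub_cst n G c : lcone n G -> meanable n (G \- cst c).
Proof.
move=> GQ; have -> : G \- cst c = G \+ (- c \*o cst 1).
  by apply/funext => x; rewrite /= mulr1.
apply: (meanableD sys); first exact: (lcone_meanable sys QQ).
exact/(meanableZ sys)/(meanable_tends sys (tends1 sys n)).
Qed.

Lemma continuous_meanable n F : continuous (slice n F) -> meanable n F.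
Proof.
move=> cF; apply: (meanable_approx sys) => e e0.
have [G [c [GQ Gc]]] := lcone_dense_base cF e0.
by exists (G \- cst c); split=> //; exact: meanable_sub_cst.
Qed.

(** Images of functions of the cone are in the cone, hence continuous, and the
    operator is bounded in the uniform norm; density does the rest. *)
Lemma continuous_ruelle n F : continuous (slice n F) ->
  continuous (slice (n + 1) (L F)).
Proof.
move=> cF x; apply/cvgrPdist_le => e e0.
pose M := D%:R * expR V + 1.
have DV : 0 <= D%:R * expR V by rewrite mulr_ge0 ?expR_ge0.
have M0 : 0 < M by rewrite ltr_wpDl.
pose d := e / 3 / M; have d0 : 0 < d by rewrite !divr_gt0.
have [G [c [GQ Gc]]] := lcone_dense_base cF d0.
pose G1 := G \- cst c.
have cone1 : lcone n (cst 1) by apply: (lcone_cst sys QQ).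
have G1E : L G1 = L G \- (c \*o L (cst 1)).
  have -> : G1 = G \- (c \*o cst 1) by apply/funext => z; rewrite /G1/= mulr1.
  have /= -> := iter_ruelleB (total_phi phi) card 1 G (c \*o cst 1).
  by have /= -> := iter_ruelleZ (total_phi phi) card 1 c (cst 1).
have LG1 : continuous (slice (n + 1) (L G1)).
  have h1 : continuous (slice (n + 1) (L G)).
    exact/lcone_continuous/(lcone_ruelle sys QQ).
  have h2 : continuous (slice (n + 1) (L (cst 1))).
    exact/lcone_continuous/(lcone_ruelle sys QQ).
  rewrite G1E; exact: (continuous_subf h1 (continuous_scalef (c := c) h2)).
have FG y : base y = n + 1 -> `|L F y - L G1 y| <= e / 3.
  move=> ly; have h : d * L (cst 1) y <= e / 3.
    rewrite /d -mulrA ler_piMr ?divr_ge0 ?(ltW e0)// mulrC ler_pdivrMr// mul1r.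
    by rewrite (le_trans (ruelle1_le card (exp_psi_le sys) y))// lerDl.
  have le1 F1 F2 : (forall z, base z = n -> F1 z <= (F2 \+ (d \*o cst 1)) z) ->
      L F1 y <= L F2 y + d * L (cst 1) y.
    move=> F12; have := le_ruelle_lev sys (k := 1) F12 ly.
    by rewrite (iter_ruelleD (total_phi phi) card) (iter_ruelleZ (total_phi phi) card).
  rewrite ler_norml; apply/andP; split.
    rewrite lerNl opprB lerBlDr addrC (le_trans (le1 _ F _)) ?lerD2l//.
    by move=> z /Gc; rewrite /G1 /= mulr1 ler_norml => /andP[]; lra.
  rewrite lerBlDr addrC (le_trans (le1 _ G1 _)) ?lerD2l//.
  by move=> z /Gc; rewrite /G1 /= mulr1 ler_norml => /andP[]; lra.
have e3 : 0 < e / 3 by rewrite divr_gt0.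
have /cvgrPdist_le/(_ _ e3) := LG1 x; apply: filterS => y.
have := FG (pt_of x) erefl; have := FG (pt_of y) erefl.
by rewrite /slice !ler_norml => /andP[? ?] /andP[? ?] /andP[? ?]; apply/andP; split; lra.
Qed.

Lemma continuous_iter_ruelle n k F : continuous (slice n F) ->
  continuous (slice (n + k%:Z) (iter k L F)).
Proof.
move=> cF; elim: k => [|k IH]; first by rewrite addr0.
by rewrite -shiftS iterS; exact: continuous_ruelle.
Qed.

Let slice_ext n (f : X n -> R) (cf : continuous f) : continuous (slice n (ext f)).
Proof. by rewrite ext_slice. Qed.

Lemma mean_functional n : positive_functional (fun f : X n -> R => mean n (ext f)).
Proof.
have mf (f : X n -> R) : continuous f -> meanable n (ext f).
  by move=> cf; exact/continuous_meanable/slice_ext.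
split=> [f g cf cg|c f cf|f cf f0].
- rewrite -(meanD sys) ?mf//; try exact: mf.
  apply: (eq_mean sys) => -[m x] /= mn.
  by case: n / mn f g {mf cf cg} => f g; rewrite !extE.
- rewrite -(meanZ sys); last exact: mf.
  apply: (eq_mean sys) => -[m x] /= mn.
  by case: n / mn f {mf cf} => f; rewrite !extE.
- apply: (mean_ge0 sys); first exact: mf.
  by move=> [m x] /= mn; case: n / mn f {mf cf} f0 => f f0; rewrite extE.
Qed.

(** * The measures *)

(** The measure m_n: integration against it is [mean n]. *)
Definition conformal n : fmeas (X n) := sval (cid (riesz (@cX n) (mean_functional n))).

Lemma pairing_conformal n (f : X n -> R) : continuous f ->
  pairing f (conformal n) = mean n (ext f).
Proof. exact: (svalP (cid (riesz (@cX n) (mean_functional n)))). Qed.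

Lemma pairing_conformal_slice n F : continuous (slice n F) ->
  pairing (slice n F) (conformal n) = mean n F.
Proof.
move=> cF; rewrite pairing_conformal//; apply: (eq_mean sys) => -[m x] /= mn.
by case: n / mn {cF}; rewrite extE.
Qed.

Local Notation W k := (iter k L (cst 1)).
Local Notation lambda := (lambda (totalT T) (total_phi phi) (@base R X)).
Local Notation K := (harnackC D tau V a Q).
Local Notation rate := (rate D tau V r a Q).
Local Notation C := (crossC D tau V r a Q).
Local Notation eigenfun := (eigenfun (totalT T) (total_phi phi) (@base R X)).

Let g01 : 0 < rate < 1 := rate_itv sys QQ.
Let g0 : 0 < rate. Proof. by case/andP: g01. Qed.
Let C0 : 0 < C := crossC_gt0 sys QQ.
Let eps0 k : 0 <= C * rate ^+ k.
Proof. by rewrite mulr_ge0 ?exprn_ge0 ?ltW. Qed.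

Lemma geometric_cvg (u : nat -> R) (l B : R) :
  (forall k, (tau <= k)%N -> `|u k - l| <= B * rate ^+ k) -> u @ \oo --> l.
Proof.
move=> ul; apply/cvgrPdist_le => e e0.
have g01' : 0 <= rate < 1 by case/andP: g01 => /ltW -> ->.
have B0 : 0 <= Num.max B 0 by rewrite le_max lexx orbT.
have [k tk ke] := geometric_le (Num.max B 0) g01' e0 tau.
exists k => // j /= kj; rewrite distrC (le_trans (ul j (leq_trans tk kj)))//.
rewrite (le_trans _ ke)// (@le_trans _ _ (Num.max B 0 * rate ^+ j))//.
  by rewrite ler_wpM2r ?exprn_ge0 ?(ltW g0)// le_max lexx.
rewrite ler_wpM2l// ler_wiXn2l ?(ltW g0)//.
by case/andP: g01 => _ /ltW.
Qed.

Lemma extD n (f g : X n -> R) : ext (f \+ g) = ext f \+ ext g.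
Proof. by apply/funext => e; rewrite /ext/=; case: eqP; rewrite ?addr0. Qed.

Lemma extZ n c (f : X n -> R) : ext (c \*o f) = c \*o ext f.
Proof. by apply/funext => e; rewrite /ext/=; case: eqP; rewrite ?mulr0. Qed.

Let cont_iter n k F (cF : continuous (slice n F)) :
  continuous (slice (n + k%:Z) (iter k L F)).
Proof. exact: (continuous_iter_ruelle). Qed.

Let cont_ext n (f : X n -> R) : continuous f -> continuous (slice n (ext f)).
Proof. by rewrite ext_slice. Qed.

Lemma continuous_sliceZ n c F : continuous (slice n F) ->
  continuous (slice n (c \*o F)).
Proof. by move=> cF; exact: (continuous_scalef (c := c) cF). Qed.

Lemma le_pairing_slice n F G (s : fmeas (X n)) : continuous (slice n F) ->
  continuous (slice n G) -> (forall x, base x = n -> F x <= G x) ->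
  pairing (slice n F) s <= pairing (slice n G) s.
Proof.
move=> cF cG FG; apply: (functional_le (pairing_functional (@cX n) s)) => // x.
exact: FG.
Qed.

Lemma pairing_sliceZ n c F (s : fmeas (X n)) : continuous (slice n F) ->
  pairing (slice n (c \*o F)) s = c * pairing (slice n F) s.
Proof. by move=> cF; rewrite -(functionalZ (pairing_functional (@cX n) s)). Qed.

Lemma pairing_dual_iter n k (s : fmeas (X (n + k%:Z))) (f : X n -> R) :
  continuous f -> pairing f (dual_iter T phi n k s) =
    pairing (slice (n + k%:Z) (iter k L (ext f))) s.
Proof.
have E g : transfer_iter T phi n k g = slice (n + k%:Z) (iter k L (ext g)).
  by rewrite -transfer_iter_slice ext_slice.
move=> cf; rewrite -E; apply: dualP cf => //; split=> [f' g cf' cg|c f' cf'|f' cf' f0].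
- rewrite !E extD (iter_ruelleD (total_phi phi) card).
  by rewrite -(functionalD (pairing_functional (@cX _) s))//; exact/cont_iter/cont_ext.
- rewrite !E extZ (iter_ruelleZ (total_phi phi) card).
  by rewrite pairing_sliceZ//; exact/cont_iter/cont_ext.
- rewrite E; apply: (functional_ge0 (pairing_functional (@cX _) s)).
    exact/cont_iter/cont_ext.
  move=> x; apply: (iter_ruelle_ge0 (total_phi phi) card) => -[m y] my.
  have nm : n = m.
    by apply: (@addIr _ k%:Z); rewrite -[m]/(base (existT _ m y)) -(lev_iter sys) my.
  by case: m / nm y my => y _; rewrite extE.
Qed.

Lemma pairing_dual_transfer n (s : fmeas (X (n + 1))) (f : X n -> R) :
  continuous f -> pairing f (dual (transfer T phi n) s) =
    pairing (slice (n + 1) (L (ext f))) s.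
Proof.
have E g : transfer T phi n g = slice (n + 1) (L (ext g)).
  by rewrite -transfer_slice ext_slice.
have cL (g : X n -> R) : continuous g -> continuous (slice (n + 1) (L (ext g))).
  by move=> cg; exact: (continuous_ruelle (cont_ext cg)).
move=> cf; rewrite -E; apply: dualP cf => //; split=> [f' g cf' cg|c f' cf'|f' cf' f0].
- rewrite !E extD; have /= -> := iter_ruelleD (total_phi phi) card 1 (ext f') (ext g).
  by rewrite -(functionalD (pairing_functional (@cX _) s))//; exact: cL.
- rewrite !E extZ; have /= -> := iter_ruelleZ (total_phi phi) card 1 c (ext f').
  by rewrite pairing_sliceZ//; exact: cL.
- rewrite E; apply: (functional_ge0 (pairing_functional (@cX _) s)); first exact: cL.
  move=> x; apply: (@iter_ruelle_ge0 _ _ _ (total_phi phi) _ card 1) => -[m y] /= my.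
  have nm : n = m by apply: (@addIr _ 1); exact: esym (congr1 tag my).
  by case: m / nm y my => y _; rewrite extE.
Qed.

Let cont1 n : continuous (slice n (cst 1) : X n -> R).
Proof. exact: continuous_cst. Qed.

Lemma continuous_iter1 n k : continuous (slice n (W k)).
Proof. by have := @cont_iter _ k _ (@cont1 (n - k%:Z)); rewrite subrK. Qed.

Lemma pairing_iter1_gt0 n k (s : fmeas (X n)) : posmeas s ->
  0 < pairing (slice n (W k)) s.
Proof.
move=> s0; apply: (@lt_le_trans _ _ (pairing (slice _ (expR (- V) ^+ k \*o cst 1)) s)).
  rewrite pairing_sliceZ//; first by rewrite mulr_gt0 ?exprn_gt0 ?expR_gt0// pairing1_gt0.
apply: le_pairing_slice; [exact/continuous_sliceZ/cont1|exact: continuous_iter1|].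
move=> x _; have [y <-] : exists y, iter k (totalT T) y = x.
  elim: k {s s0} x => [|k IH] x; first by exists x.
  by have [z <-] := fibre_neq0 card x; have [y <-] := IH z; exists y.
exact: (@iter_ruelle_ge _ _ _ _ _ _ card (exp_psi_le sys) k (cst 1) y (fun _ _ => ler01)).
Qed.

Lemma iter_ext_slice n k F : slice (n + k%:Z) (iter k L (ext (slice n F))) =
  slice (n + k%:Z) (iter k L F).
Proof. by rewrite -!transfer_iter_slice ext_slice. Qed.

(** Let A and P be the integrals of L^k f and of L^k 1 against s, and M the mean
    of f.  Integration of [iter_le_mean] and [mean_le_iter] gives
    A <= (1 + e) M P and M P <= (1 + e) A with e = C rate^k, while M and A / P
    are at most the supremum of f. *)
Lemma conformal_dist n k (s : fmeas (X (n + k%:Z))) (f : X n -> R) :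
  (tau <= k)%N -> posmeas s -> cone delta beta Q n f ->
  `|pairing f (conformal n) - pairing f (dual_iter T phi n k s) /
      pairing (cst 1) (dual_iter T phi n k s)| <= C * supnorm f * rate ^+ k.
Proof.
move=> tk s0 fQ; have cf : continuous f by case: fQ.
have [FQ _] := lcone_of_cone fQ; set F := ext f in FQ.
have [B fB] := continuous_bounded (@cX n) cf.
have supf x : `|f x| <= supnorm f.
  apply: sup_upper_bound; last by exists x.
  by split; [exists `|f x|, x|exists B => _ [y _ <-]].
have Fsup x : base x = n -> F x <= (supnorm f \*o cst 1) x.
  move: x => [m x] /= mn; case: n / mn f {cf fQ fB FQ s s0} @F supf => f F supf.
  by rewrite /F extE mulr1 (le_trans _ (supf x))// ler_norm.
have sup0 : 0 <= supnorm f by rewrite (le_trans _ (supf point)).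
have c1 : continuous (cst 1 : X n -> R) := @continuous_cst R (X n) 1.
rewrite !pairing_dual_iter// pairing_conformal//.
have -> : pairing (slice (n + k%:Z) (iter k L (ext (cst 1 : X n -> R)))) s =
    pairing (slice (n + k%:Z) (W k)) s.
  by rewrite -(iter_ext_slice n k (cst 1)).
have P0 := pairing_iter1_gt0 k s0; set P := pairing (slice _ (W k)) s in P0 *.
rewrite -/F; set A := pairing (slice _ (iter k L F)) s; set M := mean n F.
have cWk : continuous (slice (n + k%:Z) (W k)) by exact: cont_iter.
have cFk : continuous (slice (n + k%:Z) (iter k L F)) by exact/cont_iter/cont_ext.
have M0 : 0 <= M by apply: (mean_ge0 sys); [exact: (lcone_meanable sys QQ)|exact: FQ.1].
have Msup : M <= supnorm f.
  apply: (mean_le sys QQ); first exact: (lcone_meanable sys QQ).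
  by move=> x /Fsup; rewrite /= mulr1.
have A1 : A <= (1 + C * rate ^+ k) * (M * P).
  rewrite -!pairing_sliceZ//; last exact: (continuous_sliceZ cWk).
  apply: le_pairing_slice => //; first exact/continuous_sliceZ/continuous_sliceZ.
  by move=> x lx; exact: (iter_le_mean sys QQ FQ tk lx).
have A2 : M * P <= (1 + C * rate ^+ k) * A.
  rewrite -!pairing_sliceZ//.
  apply: le_pairing_slice; [exact: continuous_sliceZ..|].
  by move=> x lx; exact: (mean_le_iter sys QQ FQ tk lx).
have A3 : A <= supnorm f * P.
  rewrite -!pairing_sliceZ//; apply: le_pairing_slice => //; first exact: continuous_sliceZ.
  move=> x lx; have := le_ruelle_lev sys Fsup lx.
  by rewrite (iter_ruelleZ (total_phi phi) card).
have eA : C * rate ^+ k * A <= C * supnorm f * rate ^+ k * P.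
  rewrite (le_trans (ler_wpM2l (eps0 k) A3))// le_eqVlt; apply/orP; left.
  by apply/eqP; ring.
have eM : C * rate ^+ k * (M * P) <= C * supnorm f * rate ^+ k * P.
  have MP : M * P <= supnorm f * P by rewrite ler_wpM2r// ltW.
  rewrite (le_trans (ler_wpM2l (eps0 k) MP))// le_eqVlt; apply/orP; left.
  by apply/eqP; ring.
rewrite -(ler_pM2r P0) -[X in _ * X <= _](gtr0_norm P0) -normrM mulrBl divfK ?gt_eqF//.
move: A1 A2; rewrite !mulrDl !mul1r => A1 A2.
by rewrite ler_norml; apply/andP; split; lra.
Qed.

Let l0 n : 0 < lambda n := lambda_gt0 sys QQ n.
Let cone1 n : lcone n (cst 1) := lcone_cst sys QQ n ler01.
Let coneL1 n : lcone (n + 1) (L (cst 1)) := lcone_ruelle sys QQ (cone1 n).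

Lemma lratioE n k (s : fmeas (X (n + k.+1%:Z))) : lratio T phi n k s =
  pairing (slice _ (W k.+1)) s / pairing (slice _ (W k)) s.
Proof.
rewrite /lratio -[cst 1 : X n -> R]/(slice n (cst 1)).
rewrite -[cst 1 : X (n + 1) -> R]/(slice (n + 1) (cst 1)).
by rewrite !transfer_iter_slice castfun_slice.
Qed.

Lemma lratio_bounds n k (s : fmeas (X (n + k.+1%:Z))) : posmeas s ->
  expR (- V) <= lratio T phi n k s <= D%:R * expR V.
Proof.
move=> s0; have P0 := pairing_iter1_gt0 k s0.
have Wx x : base x = n + k.+1%:Z -> base x = n + 1 + k%:Z by rewrite shiftSl.
rewrite lratioE ler_pdivlMr// ler_pdivrMr//.
have cW j : continuous (slice (n + k.+1%:Z) (W j)) by exact: continuous_iter1.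
rewrite -!pairing_sliceZ//; apply/andP; split; apply: le_pairing_slice => //.
- exact: continuous_sliceZ.
- move=> x /Wx lx; rewrite iterSr.
  have := le_ruelle_lev sys (n := n + 1) (k := k)
    (F := expR (- V) \*o cst 1) (G := L (cst 1)) (x := x).
  rewrite (iter_ruelleZ (total_phi phi) card); apply=> // y _.
  by rewrite /= mulr1 (ruelle1_ge card (exp_psi_le sys)).
- exact: continuous_sliceZ.
- move=> x /Wx lx; rewrite iterSr.
  have := le_ruelle_lev sys (n := n + 1) (k := k)
    (F := L (cst 1)) (G := D%:R * expR V \*o cst 1) (x := x).
  rewrite (iter_ruelleZ (total_phi phi) card); apply=> // y _.
  by rewrite /= mulr1 (ruelle1_le card (exp_psi_le sys)).
Qed.

(** [iter_le_mean] and [mean_le_iter] for the function L 1 at level n + 1, whose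
    mean is lambda n. *)
Lemma lratio_lambda n k (s : fmeas (X (n + k.+1%:Z))) : posmeas s -> (tau <= k)%N ->
  lratio T phi n k s <= (1 + C * rate ^+ k) * lambda n /\
  lambda n <= (1 + C * rate ^+ k) * lratio T phi n k s.
Proof.
move=> s0 tk; have P0 := pairing_iter1_gt0 k s0.
have Wx x : base x = n + k.+1%:Z -> base x = n + 1 + k%:Z by rewrite shiftSl.
have cW j : continuous (slice (n + k.+1%:Z) (W j)) by exact: continuous_iter1.
rewrite lratioE mulrA ler_pdivrMr// ler_pdivlMr// -mulrA.
rewrite -!pairing_sliceZ//; last exact: continuous_sliceZ.
split; apply: le_pairing_slice => //; do ?exact: continuous_sliceZ.
- exact/continuous_sliceZ/continuous_sliceZ.
- by move=> x /Wx lx; rewrite iterSr (iter_le_mean sys QQ (coneL1 n) tk lx).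
- by move=> x /Wx lx; rewrite iterSr (mean_le_iter sys QQ (coneL1 n) tk lx).
Qed.

(** The estimate of [lratio_lambda] is available from k = tau on, for k + 1
    iterations; the second summand takes care of k + 1 = tau, where the crude
    bounds [lratio_bounds] are used. *)
Definition ln_lambdaC : R := C / rate + (V + ln (D%:R * expR V)) / rate ^+ tau.

Let lnD : 0 <= V + ln (D%:R * expR V).
Proof.
have /andP[h1 h2] := lambda_bounds sys (meanable_ruelle1 sys QQ 0).
have h3 := lt_le_trans (l0 0) h2.
rewrite -lerBlDl sub0r -[leLHS]expRK ler_ln ?posrE ?expR_gt0//.
exact: le_trans h1 h2.
Qed.

Lemma ln_lambda_dist n k (s : fmeas (X (n + k.+1%:Z))) : (tau <= k.+1)%N ->
  posmeas s -> `|ln (lambda n) - ln (lratio T phi n k s)| <= ln_lambdaC * rate ^+ k.+1.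
Proof.
move=> tk s0; have /andP[q1 q2] := lratio_bounds s0.
have /andP[b1 b2] := lambda_bounds sys (meanable_ruelle1 sys QQ n).
set q := lratio _ _ _ _ _ in q1 q2 *.
have q0 : 0 < q := lt_le_trans (expR_gt0 _) q1.
have D0 := lt_le_trans q0 q2.
have ln_bnd u : 0 < u -> expR (- V) <= u -> u <= D%:R * expR V ->
    - V <= ln u /\ ln u <= ln (D%:R * expR V).
  by move=> u0 u1 u2; rewrite -{1}(expRK (- V)) !ler_ln ?posrE ?expR_gt0.
rewrite /ln_lambdaC mulrDl; move: tk; rewrite leq_eqVlt => /predU1P[<-|tk].
  have [q3 q4] := ln_bnd _ q0 q1 q2; have [l3 l4] := ln_bnd _ (l0 n) b1 b2.
  rewrite divfK ?expf_neq0 ?gt_eqF// ler_wpDl//.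
    by rewrite mulr_ge0 ?exprn_ge0 ?(ltW g0)// divr_ge0 ?ltW.
  by rewrite ler_norml; apply/andP; split; lra.
have [r1 r2] := lratio_lambda s0 tk; rewrite -/q in r1 r2.
rewrite ler_wpDr//.
  by rewrite mulr_ge0 ?exprn_ge0 ?(ltW g0)// divr_ge0 ?exprn_ge0 ?(ltW g0).
rewrite exprS mulrA divfK ?gt_eqF//.
have e1 : 0 < 1 + C * rate ^+ k by rewrite ltr_wpDr.
have lne : ln (1 + C * rate ^+ k) <= C * rate ^+ k.
  by apply: le_ln1Dx; rewrite (lt_le_trans _ (eps0 k))// oppr_lt0.
have : ln q <= ln (1 + C * rate ^+ k) + ln (lambda n).
  by rewrite -lnM ?posrE// ler_ln ?posrE// mulr_gt0.
have : ln (lambda n) <= ln (1 + C * rate ^+ k) + ln q.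
  by rewrite -lnM ?posrE// ler_ln ?posrE// mulr_gt0.
by move=> h1 h2; rewrite ler_norml; apply/andP; split; lra.
Qed.

Lemma lratio_cvg n (s : forall k, fmeas (X (n + k.+1%:Z))) :
  (forall k, posmeas (s k)) ->
  (fun k => lratio T phi n k (s k)) @ \oo --> lambda n.
Proof.
move=> s0; apply: (@geometric_cvg _ _ (C * (1 + C) * lambda n)) => k tk.
have [q1 q2] := lratio_lambda (s0 k) tk; set q := lratio _ _ _ _ _ in q1 q2 *.
have gk1 : C * rate ^+ k <= C.
  by rewrite ler_piMr ?(ltW C0)// exprn_ile1 ?(ltW g0)//; case/andP: g01 => _ /ltW.
have e0 := eps0 k; set e := C * rate ^+ k in q1 q2 gk1 e0.
have -> : C * (1 + C) * lambda n * rate ^+ k = e * ((1 + C) * lambda n) by rewrite /e; ring.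
have q3 : q <= (1 + C) * lambda n.
  by rewrite (le_trans q1)// ler_wpM2r ?(ltW (l0 n))// lerD2l.
have l1 : lambda n <= (1 + C) * lambda n.
  by rewrite ler_peMl ?(ltW (l0 n))// lerDl ltW.
have := ler_wpM2l e0 q3; have := ler_wpM2l e0 l1.
rewrite !mulrDl !mul1r in q1 q2 *; rewrite !mulrDr in q1 q2 * => h1 h2.
by rewrite ler_norml; apply/andP; split; lra.
Qed.

Lemma conformal1 n : conformal n setT = 1%E.
Proof.
have h : pairing (cst 1) (conformal n) = 1.
  have := pairing_conformal_slice (F := cst 1) (@cont1 n).
  by rewrite (mean1 sys).
by rewrite -[LHS]fineK ?fin_num_measure// -pairing1 h.
Qed.

Lemma conformal_posmeas n : posmeas (conformal n).
Proof. by rewrite /posmeas/= conformal1 onee_eq0. Qed.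

Lemma normalized_pairing Y (s : fmeas Y) (f : Y -> R) : compact [set: Y] ->
  posmeas s -> continuous f ->
  pairing f (normalized s) = pairing f s / pairing (cst 1) s.
Proof.
move=> cY s0 cf; have p0 := pairing1_gt0 s0; rewrite mulrC.
apply: eq_pairing => //; first by rewrite invr_ge0 ltW.
move=> A mA; rewrite pairing1 in p0 *; rewrite /normalized/= /mnormalize.
rewrite (negbTE s0)/= ifF; first by rewrite muleC.
by apply/negbTE; rewrite -ltey -ge0_fin_numE// fin_num_measure.
Qed.

(** The integral of L^k f / L^k 1 against measures converges because the ratios
    converge uniformly to the mean of f. *)
Lemma conformal_weak_star n (s : forall k, fmeas (X (n + k%:Z))) :
  (forall k, posmeas (s k)) ->
  weak_star_cvg (fun k => normalized (dual_iter T phi n k (s k))) (conformal n).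
Proof.
move=> s0 f cf; have cF := cont_ext cf; set F := ext f in cF.
have fm : meanable n F by exact: (continuous_meanable).
rewrite pairing_conformal//.
apply/cvgrPdist_le => e e0; have [k0 k0P] := fm e e0.
exists k0 => // k /= kk; have kP := approx_leq sys kk k0P.
have d1 : pairing (cst 1) (dual_iter T phi n k (s k)) =
    pairing (slice (n + k%:Z) (W k)) (s k).
  by rewrite pairing_dual_iter ?(iter_ext_slice n k (cst 1))//; exact: continuous_cst.
have P0 := pairing_iter1_gt0 k (s0 k).
rewrite normalized_pairing//; last first.
  rewrite /posmeas/=; apply/negP => /eqP d0.
  by move: P0; rewrite -d1 pairing1 d0 ltxx.
rewrite d1 pairing_dual_iter// -/F; set P := pairing _ _ in P0 *.
set A := pairing _ _; set M := mean n F.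
have cWk : continuous (slice (n + k%:Z) (W k)) by exact: continuous_iter1.
have cFk : continuous (slice (n + k%:Z) (iter k L F)) by exact: cont_iter.
have [up lo] := (approxP _ _ _ _ _ _ _ _).1 kP.
have A1 : A <= (M + e) * P.
  by rewrite -pairing_sliceZ//; apply: le_pairing_slice => //; exact: continuous_sliceZ.
have A2 : (M - e) * P <= A.
  by rewrite -pairing_sliceZ//; apply: le_pairing_slice => //; exact: continuous_sliceZ.
rewrite -(ler_pM2r P0) -[X in _ * X <= _](gtr0_norm P0) -normrM mulrBl divfK ?gt_eqF//.
rewrite mulrDl mulrBl in A1 A2 *; rewrite ler_norml; apply/andP; split; lra.
Qed.

Lemma conformal_eigen n :
  scalar_multiple (lambda n) (dual (transfer T phi n) (conformal (n + 1))) (conformal n).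
Proof.
apply: pairing_scalar_multiple => //; first exact: ltW.
move=> f cf; have cF := cont_ext cf.
rewrite pairing_dual_transfer// (pairing_conformal cf).
rewrite pairing_conformal_slice; last first.
  exact: (continuous_ruelle cF).
apply: (mean_ruelle sys); first exact: (meanable_ruelle1 sys QQ).
exact: (continuous_meanable).
Qed.

(** For such a sequence the integral of f is the quotient of the integrals of
    L^k f and of L^k 1 against m (n + k), and L^k f is uniformly close to
    mean n f times L^k 1. *)
Lemma conformal_uniq (m : forall n, fmeas (X n)) :
  (forall n, m n setT = 1%E) ->
  (forall n, exists c, scalar_multiple c (dual (transfer T phi n) (m (n + 1))) (m n)) ->
  forall n, eqmeas (m n) (conformal n).
Proof.
move=> m1 mc n; apply: pairing_eqmeas => // f cf.
have pm n' : posmeas (m n') by rewrite /posmeas/= m1 onee_eq0.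
have pm1 n' : pairing (cst 1) (m n') = 1 by rewrite pairing1 m1.
have [c cP] : exists c : int -> R, forall n' F, continuous (slice n' F) ->
    pairing (slice (n' + 1) (L F)) (m (n' + 1)) = c n' * pairing (slice n' F) (m n').
  have /choice[c cP] := mc; exists c => n' F cF.
  have c0 : 0 <= c n'.
    have := cP n' setT measurableT; rewrite m1 mule1 => h.
    by rewrite -lee_fin -h measure_ge0.
  rewrite -(eq_pairing (@cX n') c0 cF (cP n')) pairing_dual_transfer//.
  by rewrite -!transfer_slice ext_slice.
have mk k F : continuous (slice n F) ->
    pairing (slice (n + k%:Z) (iter k L F)) (m (n + k%:Z)) =
    pairing (slice (n + k%:Z) (W k)) (m (n + k%:Z)) * pairing (slice n F) (m n).
  move=> cF; elim: k => [|k IH].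
    by rewrite addr0 /= [X in X * _](pm1 n) mul1r.
  by rewrite -shiftS !iterS !cP ?IH ?mulrA//; exact: cont_iter.
have fm : meanable n (ext f).
  by apply: (continuous_meanable); exact: cont_ext.
rewrite pairing_conformal//.
apply/eqP; rewrite -subr_eq0 -normr_le0; apply/ler_addgt0Pr => e e0.
rewrite add0r; have [k kP] := fm e e0.
have [up lo] := (approxP _ _ _ _ _ _ _ _).1 kP.
have cF := cont_ext cf; have cFk := @cont_iter _ k _ cF.
have cWk := @continuous_iter1 (n + k%:Z) k.
have P0 := pairing_iter1_gt0 k (pm (n + k%:Z)).
have := mk k _ cF; rewrite ext_slice => AE.
set P := pairing (slice _ (W k)) _ in P0 AE.
have A1 : P * pairing f (m n) <= (mean n (ext f) + e) * P.
  by rewrite -AE -pairing_sliceZ//; apply: le_pairing_slice => //; exact: continuous_sliceZ.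
have A2 : (mean n (ext f) - e) * P <= P * pairing f (m n).
  by rewrite -AE -pairing_sliceZ//; apply: le_pairing_slice => //; exact: continuous_sliceZ.
by move: A1 A2; rewrite ![P * _]mulrC !ler_pM2r// ler_norml => *; apply/andP; split; lra.
Qed.

(** * The functions *)

Lemma transfer_from_normalize n k (f : X (n - k%:Z) -> R) x :
  cone delta beta Q (n - k%:Z) f ->
  transfer_from T phi n k f x / (lprod lambda (n - k%:Z) k *
    pairing f (conformal (n - k%:Z))) =
  normalize (totalT T) (total_phi phi) (@base R X) k (ext f) (pt_of x).
Proof.
move=> fQ; have [FQ _] := lcone_of_cone fQ.
have cf : continuous f by case: fQ.
rewrite pairing_conformal// -(mean_iterE sys QQ)//.
rewrite /normalize -[base _]/n subrK; congr (_ / _).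
by rewrite -[in LHS](ext_slice f) transfer_from_slice.
Qed.

Lemma eigenfun_transfer_dist n k (f : X (n - k%:Z) -> R) x : (tau <= k)%N ->
  cone delta beta Q (n - k%:Z) f ->
  `|slice n eigenfun x - transfer_from T phi n k f x / (lprod lambda (n - k%:Z) k *
    pairing f (conformal (n - k%:Z)))| <= C * K * rate ^+ k.
Proof.
move=> tk fQ; rewrite transfer_from_normalize//.
have [FQ Fp] := lcone_of_cone fQ.
by apply: (eigenfun_dist sys QQ FQ Fp tk); rewrite subrK.
Qed.

Lemma eigenfun_uniform_cvg n (f : forall l : int, X l -> R) :
  (forall l : int, l <= n -> cone delta beta Q l (f l)) ->
  {uniform, (fun (k : nat) (x : X n) =>
    transfer_from T phi n k (f (n - k%:Z)) x /
    (lprod lambda (n - k%:Z) k * pairing (f (n - k%:Z)) (conformal (n - k%:Z))))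
    @ \oo --> slice n eigenfun}.
Proof.
move=> fQ; have g01' : 0 <= rate < 1 by case/andP: g01 => /ltW -> ->.
move=> P /uniform_nbhs[U [entU UP]].
move: entU; rewrite -entourage_ballE => -[e /= e0 eU].
have CK0 : 0 <= C * K.
  by rewrite mulr_ge0 ?(ltW C0)// (le_trans ler01 (harnackC_ge1 sys QQ)).
have [k tk ke] := geometric_le (C * K) g01' (divr_gt0 e0 (ltr0n _ 2)) tau.
exists k => // j /= kj; apply: UP => x _; apply: eU; rewrite /ball/=.
have fj : cone delta beta Q (n - j%:Z) (f (n - j%:Z)).
  by apply: fQ; rewrite gerBl.
rewrite (le_lt_trans (eigenfun_transfer_dist x (leq_trans tk kj) fj))//.
rewrite (@le_lt_trans _ _ (C * K * rate ^+ k))//.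
  rewrite ler_wpM2l// ler_wiXn2l ?(ltW g0)//; by case/andP: g01 => _ /ltW.
by rewrite (le_lt_trans ke)// ltr_pdivrMr// ltr_pMr// ltr1n.
Qed.

Lemma eigenfun_cone_slice n : cone delta beta Q n (slice n eigenfun).
Proof.
apply: (cone_of_lcone).
  exact: (eigenfun_cone sys QQ).
by exists point; rewrite gt_eqF// (eigenfun_gt0 sys QQ).
Qed.

Lemma pairing_eigenfun n : pairing (slice n eigenfun) (conformal n) = 1.
Proof.
rewrite pairing_conformal_slice.
  exact: (mean_eigenfun sys QQ).
exact: (lcone_continuous (eigenfun_cone sys QQ n)).
Qed.

Lemma transfer_eigenfun n : transfer T phi n (slice n eigenfun) =
  (fun x => lambda n * slice (n + 1) eigenfun x).
Proof.
rewrite transfer_slice; apply/funext => x.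
exact: (ruelle_eigenfun sys QQ (n := n) (x := pt_of x)).
Qed.

Lemma eigenfun_slice_uniq (h : forall n, X n -> R) :
  (forall n, cone delta beta Q n (h n) /\ pairing (h n) (conformal n) = 1) ->
  (forall n, exists c, transfer T phi n (h n) = (fun x => c * h (n + 1) x)) ->
  forall n, h n = slice n eigenfun.
Proof.
move=> hQ hc n; pose F (e : E) := h _ (tagged e).
have hF m : slice m F = h m by [].
suff -> : eigenfun = F by [].
apply/esym/(eigenfun_uniq sys QQ).
- move=> m; have [FQ _] := lcone_of_cone (hQ m).1; split.
    move=> [m' x] /= mm; case: m / mm FQ => -[F0 _].
    by have := F0 (pt_of x) erefl; rewrite extE.
  move=> [m' x] y /= mm [y' -> xy]; case: m / mm FQ => -[_ FQ].
  have := FQ (pt_of x) (pt_of y') erefl (ex_intro2 _ _ y' erefl xy).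
  by rewrite !extE.
- move=> m; have [mQ m1] := hQ m.
  by rewrite -pairing_conformal_slice ?hF//; case: mQ.
- move=> m; have [c mc] := hc m; exists c => -[m' x] /= /esym mm.
  case: m' / mm x => x.
  by have := congr1 (@^~ x) (transfer_slice T phi m F); rewrite hF mc.
Qed.

Lemma eigenfun_supnorm n k (f : X (n - k%:Z) -> R) : (tau <= k)%N ->
  cone delta beta Q (n - k%:Z) f ->
  supnorm (fun x : X n => slice n eigenfun x - transfer_from T phi n k f x /
    (lprod lambda (n - k%:Z) k * pairing f (conformal (n - k%:Z))))
  <= C * K * rate ^+ k.
Proof.
move=> tk fQ; apply: ge_sup; first by eexists; exists point.
by move=> _ [x _ <-]; exact: eigenfun_transfer_dist.
Qed.

End conformal_measures.

Theorem mainTheorem2 (R : realType) (X : int -> pmetricType R)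
    (T : forall n : int, X n -> X (n + 1))
    (phi : forall n : int, X n -> R)
    (delta beta : R) (tau : nat)
    (phi_cont : forall n, continuous (phi n))
    (A1 : condA1 T) (A2 : condA2 T delta) (A3 : condA3 T delta tau)
    (A4 : condA4 phi delta beta) :
  exists Q0 : R, 0 < Q0 /\ forall Q : R, Q0 <= Q ->
  let Lambda (n : int) : set (X n -> R) := cone delta beta Q n in
  exists (lambda : int -> R) (m : forall n : int, fmeas (X n))
         (h : forall n : int, X n -> R),
  (* [A] *)
  (forall (n : int) (sigma : forall l : int, fmeas (X l)),
     (forall l : int, n <= l -> posmeas (sigma l)) ->
     (fun k : nat => lratio T phi n k (sigma (n + k.+1%:Z))) @ \oo --> lambda n /\
     posmeas (m n) /\
     weak_star_cvg
       (fun k : nat => normalized (dual_iter T phi n k (sigma (n + k%:Z)))) (m n)) /\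
  (* [B] *)
  (forall n : int, 0 < lambda n /\ m n setT = 1%E /\
     scalar_multiple (lambda n) (dual (transfer T phi n) (m (n + 1)))
       (m n)) /\
  (* [C] *)
  (forall m' : forall n : int, fmeas (X n),
     (forall n : int, m' n setT = 1%E) ->
     (forall n : int, exists c : R,
        scalar_multiple c (dual (transfer T phi n) (m' (n + 1))) (m' n)) ->
     forall n : int, eqmeas (m' n) (m n)) /\
  (* [D] *)
  (exists C1 gamma : R, 0 < C1 /\ 0 < gamma < 1 /\
     (forall (n : int) (k : nat), (tau <= k.+1)%N ->
        forall sigma : fmeas (X (n + k.+1%:Z)), posmeas sigma ->
        `|ln (lambda n) - ln (lratio T phi n k sigma)| <= C1 * gamma ^+ k.+1) /\
     (forall (n : int) (k : nat), (tau <= k)%N ->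
        forall sigma : fmeas (X (n + k%:Z)), posmeas sigma ->
        forall f : X n -> R, Lambda n f ->
        `|pairing f (m n) -
          pairing f (dual_iter T phi n k sigma) /
          pairing (cst 1) (dual_iter T phi n k sigma)|
        <= C1 * supnorm f * gamma ^+ k)) /\
  (* [E] *)
  (forall (n : int) (f : forall l : int, X l -> R),
     (forall l : int, l <= n -> Lambda l (f l)) ->
     {uniform, (fun (k : nat) (x : X n) =>
        transfer_from T phi n k (f (n - k%:Z)) x /
        (lprod lambda (n - k%:Z) k *
         pairing (f (n - k%:Z)) (m (n - k%:Z)))) @ \oo --> h n}) /\
  (* [F] *)
  (forall n : int, (forall x : X n, 0 < h n x) /\ Lambda n (h n) /\
     pairing (h n) (m n) = 1 /\
     transfer T phi n (h n) = (fun x => lambda n * h (n + 1) x)) /\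
  (* [G] *)
  (forall h' : forall n : int, X n -> R,
     (forall n : int, Lambda n (h' n) /\ pairing (h' n) (m n) = 1) ->
     (forall n : int, exists c : R,
        transfer T phi n (h' n) = (fun x => c * h' (n + 1) x)) ->
     forall n : int, h' n = h n) /\
  (* [H] *)
  (exists C2 gamma : R, 0 < C2 /\ 0 < gamma < 1 /\
     forall (n : int) (k : nat), (tau <= k)%N ->
     forall f : X (n - k%:Z) -> R, Lambda (n - k%:Z) f ->
     supnorm (fun x : X n => h n x -
       transfer_from T phi n k f x /
       (lprod lambda (n - k%:Z) k * pairing f (m (n - k%:Z))))
     <= C2 * gamma ^+ k).
Proof.
have [D [V [H [r [a [b sys]]]]]] := total_expanding phi_cont A1 A2 A3 A4.
have cX : forall n, compact [set: X n] by case: A1.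
have delta0 : 0 < delta by case: A2.
have beta01 : 0 < beta < 1 by case: A4.
exists (Qmin D H r b); split; first exact: (Qmin_gt0 sys).
move=> Q QQ Lambda.
exists (lambda (totalT T) (total_phi phi) (@base R X)).
exists (conformal cX delta0 beta01 sys QQ).
exists (fun n => slice n (eigenfun (totalT T) (total_phi phi) (@base R X))).
have CK0 : 0 < crossC D tau V r a Q * harnackC D tau V a Q.
  rewrite mulr_gt0 ?(crossC_gt0 sys QQ)//.
  exact: lt_le_trans ltr01 (harnackC_ge1 sys QQ).
have C0 := crossC_gt0 sys QQ; have g01 := rate_itv sys QQ.
split.
  move=> n sigma sigma0; have s0 k : posmeas (sigma (n + k%:Z)).
    by apply: sigma0; rewrite lerDl.
  split; first exact: (lratio_cvg cX delta0 beta01 sys QQ (fun k => s0 k.+1)).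
  split; first exact: conformal_posmeas.
  exact: (conformal_weak_star (s := fun k => sigma (n + k%:Z))).
split.
  move=> n; split; first exact: (lambda_gt0 sys QQ).
  by split; [exact: conformal1|exact: conformal_eigen].
split; first exact: conformal_uniq.
split.
  set c1 := ln_lambdaC D tau V r a Q.
  exists (Num.max c1 (crossC D tau V r a Q)), (rate D tau V r a Q).
  have gk k : 0 <= rate D tau V r a Q ^+ k by rewrite exprn_ge0// ltW//; case/andP: g01.
  split; first by rewrite lt_max C0 orbT.
  split=> //; split=> [n k tk s s0|n k tk s s0 f fQ].
    rewrite (le_trans (ln_lambda_dist cX delta0 beta01 sys QQ tk s0))//.
    by rewrite ler_wpM2r// le_max lexx.
  rewrite (le_trans (conformal_dist cX delta0 beta01 sys QQ tk s0 fQ))//.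
  rewrite ler_wpM2r// ler_wpM2r ?le_max ?lexx ?orbT//.
  have cf : continuous f by case: fQ.
  have [B fB] := continuous_bounded (cX n) cf.
  rewrite (le_trans (normr_ge0 (f point)))//.
  apply: sup_upper_bound; last by exists point.
  by split; [exists `|f point|, point|exists B => _ [y _ <-]].
split; first exact: eigenfun_uniform_cvg.
split.
  move=> n; split; first by move=> x; exact: (eigenfun_gt0 sys QQ).
  split; first exact: (eigenfun_cone_slice delta0 beta01 sys QQ).
  by split; [exact: pairing_eigenfun|exact: (transfer_eigenfun sys QQ)].
split; first exact: eigenfun_slice_uniq.
exists (crossC D tau V r a Q * harnackC D tau V a Q), (rate D tau V r a Q).
by split=> //; split=> // n k tk f fQ; exact: eigenfun_supnorm.
Qed.
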